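(* Let $\alpha,\beta\ge1$ be real numbers and let $\lambda(\alpha,\beta)$ be the Lyapunov exponent of the random product $M_N$ of the two shear matrices $A,B$ (as defined in the context). With the functions $\hat\phi_k^{(m)},\hat\psi_k^{(m)}$ ($k\in\{1,2,\infty\}$, $m\in\{1,2,3\}$) defined in the context, let $$\hat{\mathcal{L}}_k(\alpha,\beta)=\sum_{a,b=1}^\infty 2^{-a-b}\log\left(\frac13\sum_{m=1}^3\hat\phi_k^{(m)}(a,b,\alpha,\beta)\right),\qquad \hat{\mathcal{U}}_k(\alpha,\beta)=\sum_{a,b=1}^\infty 2^{-a-b}\log\left(\frac13\sum_{m=1}^3\hat\psi_k^{(m)}(a,b,\alpha,\beta)\right).$$ Then $$\max_{k\in\{1,2,\infty\}}\hat{\mathcal{L}}_k(\alpha,\beta)\le 4\lambda(\alpha,\beta)\le\min_{k\in\{1,2,\infty\}}\hat{\mathcal{U}}_k(\alpha,\beta).$$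
   Context: For real $\alpha,\beta$ let $A=\begin{pmatrix}1&0\\ \alpha&1\end{pmatrix}$ and $B=\begin{pmatrix}1&\beta\\0&1\end{pmatrix}$. Let $M_N=\prod_{k=1}^N A_{i_k}$ be the random product in which the $N$ factors are i.i.d., each equal to $A_1=A$ or $A_2=B$ with probability $1/2$. The Lyapunov exponent is $\lambda(\alpha,\beta)=\lim_{N\to\infty}\frac1N\,\mathbb{E}\log\|M_N\|$ (independent of the matrix norm), equivalently $\lim_{N\to\infty}\frac1N\,\mathbb{E}\log\|M_NX_0\|$ for an arbitrary nonzero vector $X_0\in\mathbb{R}^2$ and any vector norm. The logarithm is natural. Functions (all of $(a,b,\alpha,\beta)$, with $a,b\ge1$ integers). Put $\mathcal{C}=(a\alpha+b\beta)^2+(a\alpha b\beta)^2$. $\hat\phi_1^{(1)}=1+\tfrac{\alpha}{1+\alpha}(a+b\beta+a\alpha b\beta)$; $\hat\phi_1^{(2)}=\dfrac{\alpha(\alpha\beta+2)(a\alpha b\beta+b\beta+1)+(a\alpha+1)(\alpha\beta+1)}{\alpha(\alpha\beta+\beta+2)+1}$; $\hat\phi_1^{(3)}=\dfrac{\alpha(2\alpha\beta+3)(a\alpha b\beta+b\beta+1)+(a\alpha+1)(\alpha\beta+1)}{\alpha(2\alpha\beta+\beta+3)+1}$; $\hat\phi_2^{(1)}=\min\left\{((1+a\alpha b\beta)^2+b^2\beta^2)^{1/2},\ \left(\tfrac1{1+\alpha^2}\left(\alpha^2(1+a+a\alpha b\beta)^2+(1+\alpha b\beta)^2\right)\right)^{1/2}\right\}$;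 $\hat\phi_2^{(2)}=\min\left\{((1+a\alpha b\beta)^2+b^2\beta^2)^{1/2},\ \left(\dfrac{(1+\alpha\beta+\alpha b\beta(2+\alpha\beta))^2+(a\alpha(1+\alpha\beta)+\alpha(2+\alpha\beta)(1+a\alpha b\beta))^2}{(1+\alpha\beta)^2+\alpha^2(2+\alpha\beta)^2}\right)^{1/2}\right\}$; $\hat\phi_2^{(3)}=\min\left\{((1+a\alpha b\beta)^2+b^2\beta^2)^{1/2},\ \left(\dfrac{(1+\alpha\beta+\alpha b\beta(3+2\alpha\beta))^2+(a\alpha(1+\alpha\beta)+\alpha(3+2\alpha\beta)(1+a\alpha b\beta))^2}{(1+\alpha\beta)^2+\alpha^2(3+2\alpha\beta)^2}\right)^{1/2}\right\}$; $\hat\phi_\infty^{(m)}=1+a\alpha b\beta$ for $m=1,2,3$; $\hat\psi_1^{(m)}=1+b\beta+a\alpha b\beta$ for $m=1,2,3$; $\hat\psi_2^{(m)}=\left(\tfrac12\left(2+\mathcal{C}+\sqrt{\mathcal{C}(\mathcal{C}+4)}\right)\right)^{1/2}$ for $m=1,2,3$; $\hat\psi_\infty^{(1)}=1+a+a\alpha b\beta$; $\quad\hat\psi_\infty^{(2)}=1+a\alpha b\beta+\dfrac{a(1+\alpha\beta)}{2+\alpha\beta}$; $\quad\hat\psi_\infty^{(3)}=1+a\alpha b\beta+\dfrac{a(1+\alpha\beta)}{3+2\alpha\beta}$. *)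

(* Defs.v *)
From mathcomp Require Export all_boot all_order all_algebra.
From mathcomp Require Export all_classical all_reals all_analysis.
Export numFieldNormedType.Exports.
Export Order.TTheory GRing.Theory Num.Theory.

#[export] Set Implicit Arguments.
#[export] Unset Strict Implicit.
#[export] Unset Printing Implicit Defensive.

#[global] Open Scope classical_set_scope.
#[global] Open Scope ring_scope.

Definition is_norm (R : realType) (V : lmodType R) (nu : V -> R) : Prop :=
  [/\ forall x y, nu (x + y) <= nu x + nu y,
      forall c x, nu (c *: x) = `|c| * nu x
    & forall x, nu x = 0 -> x = 0].

Definition mutually_independent d d' (T : measurableType d)
    (T' : measurableType d') (R : realType) (P : probability T R)
    (X : nat -> {RV P >-> T'}) : Prop :=
  forall (s : seq nat) (E : nat -> set T'), uniq s ->
    (forall i, measurable (E i)) ->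
    P (\big[setI/setT]_(i <- s) (X i @^-1` E i)) =
    (\prod_(i <- s) P (X i @^-1` E i))%E.

Definition fair_coin_flips d (T : measurableType d) (R : realType)
    (P : probability T R) (X : nat -> {RV P >-> bool}) : Prop :=
  mutually_independent X /\
  (forall k c, P (X k @^-1` [set c]) = (2^-1)%:E).

Definition shearA (R : realType) (alpha : R) : 'M[R]_2 :=
  \matrix_(i, j) (if i == j then 1 else if (j < i)%N then alpha else 0).

Definition shearB (R : realType) (beta : R) : 'M[R]_2 :=
  \matrix_(i, j) (if i == j then 1 else if (i < j)%N then beta else 0).

(* The factors are numbered from 0; the outcome [true] selects A. *)
Definition random_product d (T : measurableType d) (R : realType)
    (P : probability T R) (X : nat -> {RV P >-> bool}) (alpha beta : R)
    (N : nat) (w : T) : 'M[R]_2 :=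
  \prod_(k < N) (if X k w then shearA alpha else shearB beta).

Definition growth_rate d (T : measurableType d) (R : realType)
    (P : probability T R) (X : nat -> {RV P >-> bool}) (nu : 'M[R]_2 -> R)
    (alpha beta : R) (N : nat) : \bar R :=
  ((N%:R^-1)%:E *
   'E_P[fun w => ln (nu (random_product X alpha beta N w))])%E.

Definition lyapunov_exponent d (T : measurableType d) (R : realType)
    (P : probability T R) (X : nat -> {RV P >-> bool}) (nu : 'M[R]_2 -> R)
    (alpha beta : R) : \bar R :=
  limn (growth_rate X nu alpha beta).

Variant norm_index := k_one | k_two | k_infty.

(* The superscript m ranges over 1, 2, 3, and the wildcard branches below are
   the case m = 3; a and b are real so that they can be used in ring formulas. *)
Section Bounds.
Variable R : realType.
Implicit Types (m : nat) (k : norm_index) (a b alpha beta : R).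

Definition phihat_one m a b alpha beta : R :=
  match m with
  | 1 => 1 + alpha / (1 + alpha) * (a + b * beta + a * alpha * b * beta)
  | 2 => (alpha * (alpha * beta + 2) * (a * alpha * b * beta + b * beta + 1)
            + (a * alpha + 1) * (alpha * beta + 1))
         / (alpha * (alpha * beta + beta + 2) + 1)
  | _ => (alpha * (2 * alpha * beta + 3)
              * (a * alpha * b * beta + b * beta + 1)
            + (a * alpha + 1) * (alpha * beta + 1))
         / (alpha * (2 * alpha * beta + beta + 3) + 1)
  end.

Definition phihat_two m a b alpha beta : R :=
  Num.min
    (Num.sqrt ((1 + a * alpha * b * beta) ^+ 2 + b ^+ 2 * beta ^+ 2))
    (Num.sqrt
      match m with
      | 1 => 1 / (1 + alpha ^+ 2)
             * (alpha ^+ 2 * (1 + a + a * alpha * b * beta) ^+ 2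
                + (1 + alpha * b * beta) ^+ 2)
      | 2 => ((1 + alpha * beta + alpha * b * beta * (2 + alpha * beta)) ^+ 2
              + (a * alpha * (1 + alpha * beta)
                 + alpha * (2 + alpha * beta)
                   * (1 + a * alpha * b * beta)) ^+ 2)
             / ((1 + alpha * beta) ^+ 2
                + alpha ^+ 2 * (2 + alpha * beta) ^+ 2)
      | _ => ((1 + alpha * beta
               + alpha * b * beta * (3 + 2 * alpha * beta)) ^+ 2
              + (a * alpha * (1 + alpha * beta)
                 + alpha * (3 + 2 * alpha * beta)
                   * (1 + a * alpha * b * beta)) ^+ 2)
             / ((1 + alpha * beta) ^+ 2
                + alpha ^+ 2 * (3 + 2 * alpha * beta) ^+ 2)
      end).

Definition phihat_infty m a b alpha beta : R := 1 + a * alpha * b * beta.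

Definition psihat_one m a b alpha beta : R :=
  1 + b * beta + a * alpha * b * beta.

Definition calC a b alpha beta : R :=
  (a * alpha + b * beta) ^+ 2 + (a * alpha * b * beta) ^+ 2.

Definition psihat_two m a b alpha beta : R :=
  let C := calC a b alpha beta in
  Num.sqrt (1 / 2 * (2 + C + Num.sqrt (C * (C + 4)))).

Definition psihat_infty m a b alpha beta : R :=
  match m with
  | 1 => 1 + a + a * alpha * b * beta
  | 2 => 1 + a * alpha * b * beta
         + a * (1 + alpha * beta) / (2 + alpha * beta)
  | _ => 1 + a * alpha * b * beta
         + a * (1 + alpha * beta) / (3 + 2 * alpha * beta)
  end.

Definition phihat k : nat -> R -> R -> R -> R -> R :=
  match k with
  | k_one => phihat_one
  | k_two => phihat_two
  | k_infty => phihat_infty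
  end.

Definition psihat k : nat -> R -> R -> R -> R -> R :=
  match k with
  | k_one => psihat_one
  | k_two => psihat_two
  | k_infty => psihat_infty
  end.

(* When alpha, beta >= 1 every phihat and psihat is at least 1, so these are
   series of nonnegative terms, whose sum always exists in \bar R. *)
Definition geometric_log_sum (f : nat -> R -> R -> R -> R -> R) alpha beta
    : \bar R :=
  (\sum_(1 <= a <oo) \sum_(1 <= b <oo)
     (2^-1 ^+ (a + b)
      * ln (3^-1 * \sum_(1 <= m < 4) f m a%:R b%:R alpha beta))%:E)%E.

Definition Lhat k alpha beta : \bar R := geometric_log_sum (phihat k) alpha beta.

Definition Uhat k alpha beta : \bar R := geometric_log_sum (psihat k) alpha beta.

End Bounds.

(* Main.v *)
Require Import Defs.
From mathcomp Require Import ring lra zify.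

(* A random word splits into blocks A^a B^b whose exponents are independent and
   geometric, so a block has mean length 4 and exponents (a, b) with probability
   2^(-a-b), and 4 lambda is the mean logarithmic growth of a vector over one
   block. That growth depends only on the slope of the vector entering the
   block, and the last three letters before the block, A y z, bound this slope
   from below by alpha, alpha + alpha / (1 + alpha beta), 2 alpha or 3 alpha,
   with probability 1/4 each.

   The bounds of the theorem instead average, inside the logarithm, over the
   slopes alpha, alpha + alpha / (1 + alpha beta) and
   2 alpha + alpha / (1 + alpha beta) with weights 1/3. The four-class bounds
   are stronger: for psihat by the arithmetic-geometric mean inequality, and for
   phihat because the values y1 <= y2 <= z <= y3 of the growth at the slopes
   alpha, alpha + alpha / (1 + alpha beta), 2 alpha and
   2 alpha + alpha / (1 + alpha beta) are close enough to each other to satisfy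
   ((y1 + y2 + y3) / 3)^4 <= y1 y2 z y3.

   Upper bounds follow from the same counting argument as lower bounds, applied
   to c |w| - log |M_w v| for a constant c so large that each letter increases
   it. Convergence is Fekete's lemma, and equivalence of norms makes the limit
   independent of nu. *)

(** * Averages over words and the counting of blocks *)

Section WordMean.
Variable R : realType.
Implicit Types (f g : seq bool -> R) (s t : seq bool) (D : bool -> bool -> nat -> nat -> R).

Fixpoint word_mean N f : R :=
  if N is N'.+1 then
    (word_mean N' (fun s => f (true :: s))
     + word_mean N' (fun s => f (false :: s))) / 2
  else f [::].

Lemma le_word_mean N f g : (forall s, size s = N -> f s <= g s) ->
  word_mean N f <= word_mean N g.
Proof.
elim: N f g => [|N IH] f g fg /=; first exact: fg.
rewrite ler_pM2r ?invr_gt0// lerD// IH// => s sN; by rewrite fg//= sN.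
Qed.

Lemma eq_word_mean N f g : (forall s, size s = N -> f s = g s) ->
  word_mean N f = word_mean N g.
Proof.
by move=> fg; apply/eqP; rewrite eq_le !le_word_mean// => s sN; rewrite fg.
Qed.

Lemma word_mean_cst N c : word_mean N (fun=> c) = c.
Proof. by elim: N => //= N ->; field. Qed.

Lemma word_meanD N f g :
  word_mean N (fun s => f s + g s) = word_mean N f + word_mean N g.
Proof. by elim: N f g => //= N IH f g; rewrite !IH; ring. Qed.

Lemma word_meanB N f g :
  word_mean N (fun s => f s - g s) = word_mean N f - word_mean N g.
Proof. by elim: N f g => //= N IH f g; rewrite !IH; ring. Qed.

Lemma word_mean_cat m n f : word_mean (m + n) f =
  word_mean m (fun s => word_mean n (fun t => f (s ++ t))).
Proof. by elim: m f => //= m IH f; rewrite !IH. Qed.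

(** Conditions on the length of the initial run of [x], which is exactly [a] with probability
    [2^-1 ^+ a.+1]. Runs of length [K] or more are dropped, as [f] is nonnegative; [n] is the number
    of letters needed after the end of the run. *)
Lemma word_mean_run x K n f (g : nat -> R) : (forall s, 0 <= f s) ->
  (forall a m, (n <= m)%N -> g a <= word_mean m (fun s => f (nseq a x ++ ~~ x :: s))) ->
  forall m, (n + K <= m)%N ->
  \sum_(0 <= a < K) 2^-1 ^+ a.+1 * g a <= word_mean m f.
Proof.
elim: K f g => [|K IH] f g f0 fg m nKm.
  rewrite big_geq// -(word_mean_cst m 0).
  exact: le_word_mean.
case: m nKm => [|m]; first by rewrite addnS.
rewrite addnS ltnS => nKm.
rewrite big_nat_recl//= expr1.
have -> : word_mean m (fun s => f (true :: s)) + word_mean m (fun s => f (false :: s))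
   = word_mean m (fun s => f (x :: s)) + word_mean m (fun s => f (~~ x :: s)).
  by case: x {IH fg} => //=; rewrite addrC.
under eq_bigr do rewrite exprS -mulrA.
rewrite -mulr_sumr -mulrDr mulrC ler_pM2r ?invr_gt0// addrC lerD//; last first.
  by apply: (fg 0%N); apply: leq_trans nKm; rewrite leq_addr.
by apply: (IH (fun s => f (x :: s)) (fun a => g a.+1)) => // a k nk; exact: fg.
Qed.

Fixpoint drop_run x s : seq bool :=
  if s is y :: s' then (if y == x then drop_run x s' else s) else [::].

Fixpoint run_length x s : nat :=
  if s is y :: s' then (if y == x then (run_length x s').+1 else 0) else 0.

Lemma cat_run x s : nseq (run_length x s) x ++ drop_run x s = s.
Proof. by elim: s => //= y s IH; case: eqP => //= ->; rewrite IH. Qed.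

Lemma drop_run_nseq x a s : drop_run x (nseq a x ++ ~~ x :: s) = ~~ x :: s.
Proof. by elim: a => [|a IH] /=; [case: x|rewrite eqxx]. Qed.

Lemma run_length_nseq x a s : run_length x (nseq a x ++ ~~ x :: s) = a.
Proof. by elim: a => [|a IH] /=; [case: x|rewrite eqxx IH]. Qed.

(* The head of a word is its last letter in time, so a word starts with its most
   recent block, a run of [true] (the letter A) followed by a run of [false]. *)
Definition block_tail s := drop_run false (drop_run true s).

(** The tail of a block starts with [true] unless it is empty, so the inner match gives 0 only to
    blocks with fewer than three letters before them. *)
Definition block_gain D s : R :=
  let a := run_length true s in
  let b := run_length false (drop_run true s) in
  if (0 < a)%N && (0 < b)%N then
    if block_tail s is [:: true, y, z & _] then D y z a b else 0
  else 0.

(* The gain of a block is counted once, when a B following its run of A's shows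
   that the block is complete. *)
Fixpoint total_gain D s : R :=
  if s is x :: s' then
    total_gain D s' + (if x then 0 else block_gain D s')
  else 0.

(** Abstract in [f] and [D] because it is used twice: for the logarithm of the norm and for its
    defect from linear growth. *)
Definition block_bounded f D := forall a b y z s, (0 < a)%N -> (0 < b)%N ->
  let t := [:: true, y, z & s] in
  f t + D y z a b <= f (nseq a true ++ nseq b false ++ t).

Lemma block_gain_le f D s : (forall x s, f s <= f (x :: s)) ->
  block_bounded f D -> f (block_tail s) + block_gain D s <= f s.
Proof.
move=> fmono fD.
have fcat u t : f t <= f (u ++ t).
  by elim: u => //= x u IH; exact: le_trans IH (fmono _ _).
have sE : s = nseq (run_length true s) true
    ++ nseq (run_length false (drop_run true s)) false ++ block_tail s.
  by rewrite /block_tail !cat_run.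
have tail_le : f (block_tail s) <= f s by rewrite {2}sE catA.
rewrite /block_gain; case: ifPn => [/andP[a0 b0]|]; last by rewrite addr0.
case tE : (block_tail s) tail_le => [|[] [|y [|z t]]] tail_le; rewrite ?addr0//.
by rewrite {3}sE tE; exact: fD.
Qed.

(** The bound is on the tail because the most recent block is not counted yet. It is counted when a
    new [false] makes that block part of the tail, and [block_gain_le] then pays for it. *)
Lemma total_gain_le_tail f D s : (forall x s, f s <= f (x :: s)) ->
  block_bounded f D -> f [::] + total_gain D s <= f (block_tail s).
Proof.
move=> fmono fD; elim: s => [|[] s IH] /=; first by rewrite addr0.
  by rewrite addr0.
case: s IH => [|[] s] IH /=.
- by rewrite /block_gain /= !addr0.
- rewrite addrA; apply: le_trans (block_gain_le _ fmono fD).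
  by rewrite lerD2r.
- by rewrite [block_gain _ _]/block_gain /= addr0.
Qed.

Lemma total_gain_le f D s : (forall x s, f s <= f (x :: s)) ->
  block_bounded f D -> (forall y z a b, 0 <= D y z a b) ->
  f [::] + total_gain D s <= f s.
Proof.
move=> fmono fD D0; apply: le_trans (total_gain_le_tail s fmono fD) _.
apply: le_trans (block_gain_le s fmono fD); rewrite lerDl /block_gain.
by case: ifP => // _; case: (block_tail s) => [|[] [|y [|z t]]].
Qed.

Definition class_mean D a b : R :=
  (D true true a b + D true false a b + D false true a b + D false false a b) / 4.

(** A word starts with exactly [a] letters A, exactly [b] letters B and then an A with probability
    [2^-1 ^+ (a + b).+1], and the two letters that follow are uniform. A length of [3 + K + K] has
    room for all of this when [a] and [b] are at most [K]. *)
Lemma block_gain_mean D K m : (forall y z a b, 0 <= D y z a b) ->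
  (3 + K + K <= m)%N ->
  2^-1 * \sum_(1 <= a < K.+1) \sum_(1 <= b < K.+1)
    2^-1 ^+ (a + b) * class_mean D a b <= word_mean m (block_gain D).
Proof.
move=> D0 Km.
have gain0 s : 0 <= block_gain D s.
  rewrite /block_gain.
  by case: ifP => // _; case: (block_tail s) => [|[] [|y [|z t]]].
have inner a n : (0 < a)%N -> (2 + K <= n)%N ->
    \sum_(1 <= b < K.+1) 2^-1 ^+ b * class_mean D a b
    <= word_mean n (fun s => block_gain D (nseq a true ++ false :: s)).
  move=> a0 Kn; rewrite big_add1 /=.
  apply: (@word_mean_run false K 2 _ (fun b => class_mean D a b.+1)) => //.
  move=> b m' m'2 /=.
  have gE s : block_gain D (nseq a true ++ false :: nseq b false ++ [:: true & s])
      = if s is [:: y, z & _] then D y z a b.+1 else 0.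
    rewrite /block_gain /block_tail (run_length_nseq true) (drop_run_nseq true) a0 /=.
    by rewrite (run_length_nseq false) (drop_run_nseq false); case: s => [|? []].
  case: m' m'2 => [|[|m']]//= _.
  rewrite /class_mean.
  have gE2 y z : word_mean m' (fun s => block_gain D
      (nseq a true ++ false :: nseq b false ++ [:: true, y, z & s])) = D y z a b.+1.
    by rewrite -[RHS](word_mean_cst m'); apply: eq_word_mean => s _; rewrite gE.
  by rewrite !gE2 le_eqVlt; apply/orP; left; apply/eqP; field.
(* Run lengths are counted from 0 here; the empty run of A's gets the value 0. *)
have outer : \sum_(0 <= a < K.+1) 2^-1 ^+ a.+1 *
   (if a is 0 then 0 else \sum_(1 <= b < K.+1) 2^-1 ^+ b * class_mean D a b)
    <= word_mean m (block_gain D).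
  apply: (@word_mean_run true K.+1 (2 + K)) => //; last by rewrite addnS -addSn.
  move=> [|a] m' m'2; last exact: inner.
  rewrite -(word_mean_cst m' 0); exact: le_word_mean.
apply: le_trans outer.
rewrite [leRHS]big_ltn//= mulr0 add0r mulr_sumr; apply: ler_sum_nat => a /andP[a0 _].
rewrite big_distrr /= [X in _ * X](_ : _ =
  \sum_(1 <= b < K.+1) 2^-1 ^+ b * class_mean D a b); last by case: a a0.
rewrite big_distrr/=; apply: ler_sum => b _.
by rewrite le_eqVlt exprD exprS !mulrA eqxx.
Qed.
End WordMean.

(** * Limits of averages per letter: Fekete's lemma and the rate of gain *)

Section Rate.
Variable R : realType.
Implicit Types (f g : seq bool -> R) (s t : seq bool) (D : bool -> bool -> nat -> nat -> R).

Lemma cvg_divn (c : R) : (fun n => c / n%:R) @ \oo --> (0 : R).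
Proof.
apply/cvgrPdist_lt => e e0; near=> n.
rewrite sub0r normrN normrM normfV (ger0_norm (ler0n _ _)).
have n0 : (0 : R) < n%:R by rewrite ltr0n; near: n; exact: nbhs_infty_gt.
rewrite ltr_pdivrMr// mulrC -ltr_pdivrMr//.
by near: n; exact: nbhs_infty_gtr.
Unshelve. all: by end_near. Qed.

Lemma cvg_divn_le (u : nat -> R) (S C l : R) n0 :
  (forall n, (n0 <= n)%N -> S * n%:R - C <= u n) ->
  u n / n%:R @[n --> \oo] --> l -> S <= l.
Proof.
move=> uS ul; apply/ler_addgt0Pr => e e0; apply: ltW.
have e2 : 0 < e / 2 by rewrite divr_gt0.
near \oo => n.
have n0' : (0 : R) < n%:R by rewrite ltr0n; near: n; exact: nbhs_infty_gt.
have h1 : `|l - u n / n%:R| < e / 2.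
  by near: n; move/cvgrPdist_lt : ul; exact.
have h2 : `|0 - C / n%:R| < e / 2.
  by near: n; move/cvgrPdist_lt : (cvg_divn C); exact.
have /uS h3 : (n0 <= n)%N by near: n; exact: nbhs_infty_ge.
have h4 : S - C / n%:R <= u n / n%:R.
  by rewrite ler_pdivlMr// mulrBl divfK ?gt_eqF.
rewrite ltr_norml in h1; rewrite ltr_norml in h2.
by lra.
Unshelve. all: by end_near. Qed.

(** The limit is the infimum of the quotients: if [p.+1] nearly attains it, dividing [n] by [p.+1]
    with remainder bounds [a n / n] up to an error [C / n]. *)
Lemma fekete (a : nat -> R) : (forall n, 0 <= a n) ->
  (forall m n, a (m + n)%N <= a m + a n) ->
  exists l : R, a n / n%:R @[n --> \oo] --> l.
Proof.
move=> a0 sub.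
pose A := [set a n.+1 / n.+1%:R | n in [set: nat]]%classic.
have hA : has_inf A.
  split; first by exists (a 1 / 1), 0%N.
  by exists 0 => _ [n _ <-]; rewrite divr_ge0.
have amul q p r : a (q * p + r)%N <= q%:R * a p + a r.
  elim: q => [|q IH]; first by rewrite mul0r add0r.
  rewrite mulSn -addnA (le_trans (sub _ _))// -natr1.
  by rewrite mulrDl mul1r; move: IH; lra.
exists (inf A).
suff lim_a (e : R) : 0 < e -> \forall n \near \oo, `|inf A - a n / n%:R| < e.
  by apply/cvgrPdist_lt => e; exact: lim_a.
move=> e0.
have e2 : 0 < e / 2 by rewrite divr_gt0.
have [_ [p _ <-] hp] := inf_adherent e2 hA.
near=> n.
have n0' : (0 : R) < n%:R by rewrite ltr0n; near: n; exact: nbhs_infty_gt.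
(* [C] bounds [a r] for every remainder [r] modulo [p.+1]. *)
set C := p.+1%:R * a 1%N + a 0%N.
have h2 : `|0 - C / n%:R| < e / 2.
  by near: n; move/cvgrPdist_lt : (cvg_divn C); exact.
have inf_le : inf A <= a n / n%:R.
  apply: (ge_inf hA.2); exists n.-1 => //.
  by rewrite prednK// -(ltr0n R).
have : a n / n%:R <= a p.+1 / p.+1%:R + C / n%:R.
  rewrite ler_pdivrMr// mulrDl divfK ?gt_eqF//.
  rewrite {1}(div.divn_eq n p.+1) (le_trans (amul _ _ _))// lerD//.
    rewrite mulrAC ler_pdivlMr// mulrAC -[X in _ <= X]mulrC ler_wpM2r//.
    by rewrite -natrM ler_nat leq_trunc_div.
  rewrite -{1}(muln1 (n %% p.+1)%N) -(addn0 (_ * 1)%N) (le_trans (amul _ _ _))//.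
  rewrite /C lerD2r ler_wpM2r// ler_nat ltnW// ltn_mod//.
rewrite ltr_norml in h2; rewrite ltr_norml.
move: (a p.+1 / _) hp (C / _) h2 (a n / _) inf_le => x1 h1 x2 h2 x3 h3 h5.
by lra.
Unshelve. all: by end_near. Qed.

(** Prepending a letter to [s] adds [block_gain D s] when the letter is B, hence at least [c / 2] on
    average. *)
Lemma total_gain_mean D c n0 : (forall y z a b, 0 <= D y z a b) ->
  (forall m, (n0 <= m)%N -> c <= word_mean m (block_gain D)) ->
  forall n, n%:R * (c / 2) <= word_mean (n0 + n) (total_gain D).
Proof.
move=> D0 gc.
have gain0 s : 0 <= block_gain D s.
  rewrite /block_gain.
  by case: ifP => // _; case: (block_tail s) => [|[] [|y [|z t]]].
elim=> [|n IH].
  rewrite mul0r -(word_mean_cst (n0 + 0) 0); apply: le_word_mean => s _.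
  by elim: s => //= x s IH; rewrite addr_ge0//; case: x.
rewrite addnS /= !word_meanD word_mean_cst.
have := gc (n0 + n)%N (leq_addr _ _).
by rewrite -natr1 mulrDl mul1r; move: IH; lra.
Qed.

(** The factor 4 is made of two halvings: the [2^-1] of [block_gain_mean], and the probability of
    the letter B that completes a block. *)
Lemma block_sum_le_rate f D K (l : R) : (forall x s, f s <= f (x :: s)) ->
  block_bounded f D -> (forall y z a b, 0 <= D y z a b) ->
  word_mean n f / n%:R @[n --> \oo] --> l ->
  \sum_(1 <= a < K.+1) \sum_(1 <= b < K.+1) 2^-1 ^+ (a + b) * class_mean D a b
  <= 4 * l.
Proof.
move=> fmono fD D0 fl; set S := (X in X <= _).
suff : S / 4 <= l by rewrite ler_pdivrMr// mulrC.
pose n0 := (3 + K + K)%N.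
apply: (@cvg_divn_le _ _ (n0%:R * (S / 4) - f [::]) _ n0 _ fl) => n n0n.
have := @total_gain_mean D (2^-1 * S) n0 D0 (fun m => block_gain_mean D0) (n - n0)%N.
rewrite subnKC// natrB// => h.
apply: (@le_trans _ _ (word_mean n (fun s => f [::] + total_gain D s))); last first.
  by apply: le_word_mean => s _; exact: total_gain_le.
by rewrite word_meanD word_mean_cst; move: h; lra.
Qed.
End Rate.

(** * Growth of a vector over one block as a function of its slope *)

Section Growth.
Variable R : realType.
Implicit Types (p q u v s t al : R) (k : norm_index) (w : R * R).

(** The four numbers are [1], [1 + y], [1 + z] and [1 + w], and the mean leaves out [1 + z]. Moving
    [y] up to [z], then [z] down to [2 / 3 * w], leaves a polynomial inequality in [w] alone on
    [[0, 3 / 7]]. *)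
Lemma pow4_mean_le_prod1 (y z w : R) : 0 <= y -> y <= z -> z <= w ->
  w <= 3 / 2 * z -> w <= 3 / 7 ->
  ((3 + y + w) / 3) ^+ 4 <= (1 + y) * (1 + z) * (1 + w).
Proof.
move=> y0 yz zw wz w37.
pose M t : R := 1 + (t + w) / 3.
have M0 t : 0 <= t -> 0 < M t by rewrite /M => ?; lra.
(* The largest value [y = z] is the worst one. *)
have step1 : M y ^+ 4 * (1 + z) <= M z ^+ 4 * (1 + y).
  (* The fourth power lies above its tangent at [M y], which reduces the claim to
     [M y <= 4 / 3 * (1 + y)]. *)
  have tangent : M y ^+ 4 + 4 * M y ^+ 3 * ((z - y) / 3) <= M z ^+ 4.
    have -> : M z = M y + (z - y) / 3 by rewrite /M; field.
    set e := (z - y) / 3; have e0 : 0 <= e by rewrite /e; lra.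
    have := M0 _ y0; move: (M y) => m m0.
    have -> : (m + e) ^+ 4 = m ^+ 4 + 4 * m ^+ 3 * e
       + (6 * m ^+ 2 * e ^+ 2 + 4 * m * e ^+ 3 + e ^+ 4) by ring.
    have m0' := ltW m0.
    by clearbody e; rewrite lerDl !addr_ge0 ?mulr_ge0 ?exprn_ge0 ?ler0n.
  have y1 : 0 <= 1 + y by lra.
  apply: le_trans (ler_wpM2r y1 tangent).
  have -> : M y ^+ 4 * (1 + z) = M y ^+ 4 * (1 + y) + M y ^+ 3 * (M y * (z - y)).
    by ring.
  have -> : (M y ^+ 4 + 4 * M y ^+ 3 * ((z - y) / 3)) * (1 + y)
    = M y ^+ 4 * (1 + y) + M y ^+ 3 * (4 / 3 * (1 + y) * (z - y)) by field.
  rewrite lerD2l ler_wpM2l// ?exprn_ge0 ?(ltW (M0 _ y0))// ler_wpM2r ?subr_ge0//.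
  by rewrite /M; lra.
(* Then the smallest value [z = 2 / 3 * w] is the worst one. *)
have step2 : M z ^+ 2 * (1 + 2 / 3 * w) <= M (2 / 3 * w) ^+ 2 * (1 + z).
  rewrite /M -subr_ge0.
  have -> : (1 + (2 / 3 * w + w) / 3) ^+ 2 * (1 + z)
      - (1 + (z + w) / 3) ^+ 2 * (1 + 2 / 3 * w)
    = (z - 2 / 3 * w) * (1 / 3 + 7 / 27 * w + 1 / 27 * w ^+ 2
      + (w - z) * (1 / 9 + 2 / 27 * w)) by field.
  have ? : 0 <= w by lra.
  have ? : 0 <= w ^+ 2 by rewrite sqr_ge0.
  have ? : 0 <= (w - z) * (1 / 9 + 2 / 27 * w) by apply: mulr_ge0; lra.
  by apply: mulr_ge0; lra.
have step3 : M (2 / 3 * w) ^+ 4 <= (1 + 2 / 3 * w) ^+ 2 * (1 + w).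
  rewrite /M; have w0 : 0 <= w by lra.
  rewrite -subr_ge0.
  have -> : (1 + 2 / 3 * w) ^+ 2 * (1 + w) - (1 + (2 / 3 * w + w) / 3) ^+ 4
    = w * (1 / 9 - 2 / 27 * w - 176 / 729 * w ^+ 2 - 625 / 6561 * w ^+ 3) by field.
  apply: mulr_ge0; first exact: w0.
  have h2 : w ^+ 2 <= 3 / 7 * w by rewrite expr2; nra.
  have h3 : w ^+ 3 <= 3 / 7 * w ^+ 2
    by rewrite (exprS w 2); apply: ler_wpM2r; [exact: sqr_ge0|exact: w37].
  by lra.
have z0 : 0 < 1 + z by lra.
(* Combine the square of [step2] with [step3]; the factor [(1 + 2 / 3 * w) ^+ 2] cancels. *)
have step4 : M z ^+ 4 <= (1 + z) ^+ 2 * (1 + w).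
  have a0 : 0 < (1 + 2 / 3 * w) by lra.
  rewrite -(ler_pM2r (exprn_gt0 2 a0)).
  apply: (@le_trans _ _ ((M (2 / 3 * w) ^+ 2 * (1 + z)) ^+ 2)).
    have -> : M z ^+ 4 * (1 + 2 / 3 * w) ^+ 2 = (M z ^+ 2 * (1 + 2 / 3 * w)) ^+ 2 by ring.
    by rewrite lerXn2r// nnegrE mulr_ge0// ?sqr_ge0 ?ltW//.
  have -> : (M (2 / 3 * w) ^+ 2 * (1 + z)) ^+ 2 = (1 + z) ^+ 2 * M (2 / 3 * w) ^+ 4 by ring.
  rewrite [leRHS](_ : _ = (1 + z) ^+ 2 * ((1 + 2 / 3 * w) ^+ 2 * (1 + w))); last by ring.
  by apply: ler_wpM2l; first exact: sqr_ge0.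
have -> : (3 + y + w) / 3 = M y by rewrite /M; field.
rewrite -(ler_pM2r z0) (le_trans step1)//.
have -> : (1 + y) * (1 + z) * (1 + w) * (1 + z) = (1 + z) ^+ 2 * (1 + w) * (1 + y) by ring.
by rewrite ler_wpM2r//; lra.
Qed.

(** By homogeneity, division by [y1] reduces this to [pow4_mean_le_prod1]; the last two hypotheses
    become [w <= 3 / 2 * z] and [w <= 3 / 7]. *)
Lemma pow4_mean_le_prod (y1 y2 z y3 : R) : 0 < y1 -> y1 <= y2 -> y2 <= z ->
  z <= y3 -> y3 - y1 <= 3 / 2 * (z - y1) -> y3 <= 10 / 7 * y1 ->
  ((y1 + y2 + y3) / 3) ^+ 4 <= y1 * y2 * z * y3.
Proof.
move=> y10 y12 y2z zy3 h1 h2.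
have y1N0 : y1 != 0 by rewrite gt_eqF.
have H : ((3 + (y2 / y1 - 1) + (y3 / y1 - 1)) / 3) ^+ 4
     <= (1 + (y2 / y1 - 1)) * (1 + (z / y1 - 1)) * (1 + (y3 / y1 - 1)).
  apply: pow4_mean_le_prod1.
  - by rewrite subr_ge0 ler_pdivlMr// mul1r.
  - by rewrite lerD2r ler_pM2r ?invr_gt0.
  - by rewrite lerD2r ler_pM2r ?invr_gt0.
  - have sub1 t : t / y1 - 1 = (t - y1) / y1 by rewrite mulrBl divff.
    by rewrite !sub1 mulrA ler_pM2r ?invr_gt0.
  - rewrite lerBlDr ler_pdivrMr//; lra.
have -> : (y1 + y2 + y3) / 3 = y1 * ((3 + (y2 / y1 - 1) + (y3 / y1 - 1)) / 3).
  by field.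
have -> : y1 * y2 * z * y3 = y1 ^+ 4 *
    ((1 + (y2 / y1 - 1)) * (1 + (z / y1 - 1)) * (1 + (y3 / y1 - 1))) by field.
by rewrite exprMn ler_wpM2l// exprn_ge0// ltW.
Qed.

(** The image of [w] under [A^a B^b], with [p = a alpha] and [q = b beta]. *)
Definition block_vec p q w : R * R :=
  (w.1 + q * w.2, p * w.1 + (1 + p * q) * w.2).

(** Absolute values are left out, as the vectors involved have nonnegative coordinates. *)
Definition vnorm k w : R :=
  match k with
  | k_one => w.1 + w.2
  | k_two => Num.sqrt (w.1 ^+ 2 + w.2 ^+ 2)
  | k_infty => Num.max w.1 w.2
  end.

Definition sqr_growth p q s : R :=
  ((1 + q * s) ^+ 2 + (p + (1 + p * q) * s) ^+ 2) / (1 + s ^+ 2).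

(* The growth of (1, s) under A^a B^b, where p = a alpha and q = b beta. In the
   Euclidean norm this is not monotone in [s], but it is smallest at an end of
   each interval of positive slopes, hence the minimum with the growth of (0, 1). *)
Definition growth k p q s : R :=
  match k with
  | k_one => ((1 + p) + (1 + q + p * q) * s) / (1 + s)
  | k_two => Num.min (Num.sqrt ((1 + p * q) ^+ 2 + q ^+ 2))
                     (Num.sqrt (sqr_growth p q s))
  | k_infty => 1 + p * q
  end.

Lemma growth_le k p q s u v : 0 <= p -> 1 <= q -> 1 <= s -> 0 < u -> s * u <= v ->
  growth k p q s * vnorm k (u, v) <= vnorm k (block_vec p q (u, v)).
Proof.
move=> p0 q1 s1 u0 suv; have s0 : 0 < 1 + s by lra.
have v0 : 0 <= v by nra.
case: k => /=.
- rewrite mulrAC ler_pdivrMr//.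
  have h : 0 <= p * (q - 1) + q by nra.
  rewrite -subr_ge0.
  have -> : (u + q * v + (p * u + (1 + p * q) * v)) * (1 + s)
    - (1 + p + (1 + q + p * q) * s) * (u + v)
    = (p * (q - 1) + q) * (v - s * u) by ring.
  by rewrite mulr_ge0// subr_ge0.
- set m := Num.min _ _.
  have m0 : 0 <= m by rewrite /m le_min !sqrtr_ge0.
  have mE : m ^+ 2 <= (1 + p * q) ^+ 2 + q ^+ 2.
    rewrite -[leRHS]sqr_sqrtr ?addr_ge0 ?sqr_ge0// lerXn2r ?nnegrE ?sqrtr_ge0//.
    by rewrite /m ge_min lexx.
  have ss : 0 < 1 + s ^+ 2 by nra.
  have mQ : m ^+ 2 <= sqr_growth p q s.
    rewrite -[leRHS]sqr_sqrtr; last first.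
      by rewrite /sqr_growth divr_ge0 ?addr_ge0 ?sqr_ge0.
    rewrite lerXn2r ?nnegrE ?sqrtr_ge0//.
    by rewrite /m ge_min lexx orbT.
  rewrite /sqr_growth ler_pdivlMr// in mQ.
  rewrite -[m]ger0_norm// -sqrtr_sqr -sqrtrM ?sqr_ge0// ler_wsqrtr//.
  have pq0 : 0 <= p * q by nra.
  have := sqr_ge0 m; move: (m ^+ 2) mE mQ => {m m0} m mE mQ m0.
  (* Split [(u, v)] as [(u, s * u) + (0, r)]. Every term of the expansion is nonnegative, since [m]
     is at most the squared growth of either summand. *)
  set r := v - s * u; have r0 : 0 <= r by rewrite /r subr_ge0.
  have -> : v = s * u + r by rewrite /r; ring.
  rewrite -subr_ge0.
  have -> : (u + q * (s * u + r)) ^+ 2 + (p * u + (1 + p * q) * (s * u + r)) ^+ 2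
     - m * (u ^+ 2 + (s * u + r) ^+ 2)
   = u ^+ 2 * ((1 + q * s) ^+ 2 + (p + (1 + p * q) * s) ^+ 2 - m * (1 + s ^+ 2))
     + (2 * u * r * s + r ^+ 2) * ((1 + p * q) ^+ 2 + q ^+ 2 - m)
     + 2 * u * r * (q + p * (1 + p * q)) by ring.
  rewrite !addr_ge0 ?mulr_ge0 ?subr_ge0 ?sqr_ge0 ?addr_ge0 ?mulr_ge0 ?sqr_ge0//; try lra.
- have uv : u <= v by nra.
  have pq0 : 0 <= p * q by nra.
  rewrite (max_idPr uv) le_max; apply/orP; right.
  by rewrite lerDr mulr_ge0// ltW.
Qed.

(** Follows from [growth_le] for the vector [(1, t)]; in the Euclidean case the other argument of
    the minimum does not depend on the slope. *)
Lemma growth_mono k p q s t : 0 <= p -> 1 <= q -> 1 <= s -> s <= t ->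
  growth k p q s <= growth k p q t.
Proof.
move=> p0 q1 s1 st.
have t0 : 0 < 1 + t by lra.
have tt : 0 < 1 + t ^+ 2 by nra.
have := @growth_le k p q s 1 t p0 q1 s1 ltr01; rewrite mulr1 => /(_ st).
case: k => //=.
- rewrite -ler_pdivlMr// => /le_trans; apply.
  rewrite ler_pM2r ?invr_gt0// le_eqVlt; apply/orP; left; apply/eqP; ring.
- rewrite expr1n -ler_pdivlMr ?sqrtr_gt0// => h.
  rewrite le_min; apply/andP; split; first by rewrite ge_min lexx.
  apply: le_trans h _.
  rewrite /sqr_growth sqrtrM ?addr_ge0 ?sqr_ge0// sqrtrV; last exact: ltW.
  by rewrite mulr1; exact: lexx.
Qed.

Lemma growth_gt0 k p q s : 0 <= p -> 1 <= q -> 1 <= s -> 0 < growth k p q s.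
Proof.
move=> p0 q1 s1; have pq0 : 0 <= p * q by nra.
case: k => /=; last by lra.
- apply: divr_gt0; last by lra.
  by apply: ltr_wpDr; [apply: mulr_ge0|]; lra.
- rewrite lt_min !sqrtr_gt0; apply/andP; split.
    by apply: ltr_pwDl; [apply: exprn_gt0; lra|exact: sqr_ge0].
  have h : 0 < 1 + q * s by nra.
  apply: divr_gt0; first by apply: ltr_pwDl; [exact: exprn_gt0|exact: sqr_ge0].
  by apply: ltr_pwDl; [exact: ltr01|exact: sqr_ge0].
Qed.

(** In the Gram matrix of [A^a B^b], [F] is the difference of the diagonal entries and [D] is the
    off-diagonal entry. *)
Lemma sqr_growthB p q s al : sqr_growth p q s - sqr_growth p q al =
  let F := q ^+ 2 + (1 + p * q) ^+ 2 - 1 - p ^+ 2 in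
  let D := q + p * (1 + p * q) in
  (s - al) * (F * al + 2 * D + s * (F - 2 * D * al)) /
  ((1 + s ^+ 2) * (1 + al ^+ 2)).
Proof.
have h t : 1 + t ^+ 2 != 0.
  by apply: lt0r_neq0; apply: ltr_pwDl; [exact: ltr01|exact: sqr_ge0].
rewrite /sqr_growth /=; field; by rewrite !h.
Qed.

(** The factor [s - al] is at most [3 / 2 * al], and [(A + s * B) / (1 + s ^+ 2)] is at most its
    value at [2 * al]. *)
Lemma slope_quotient_concave (A B al s : R) : 0 <= A -> 0 <= B -> 1 <= al ->
  2 * al <= s -> s <= 5 / 2 * al ->
  (s - al) * (A + s * B) / ((1 + s ^+ 2) * (1 + al ^+ 2)) <=
  3 / 2 * ((2 * al - al) * (A + 2 * al * B)
           / ((1 + (2 * al) ^+ 2) * (1 + al ^+ 2))).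
Proof.
move=> A0 B0 al1 als sal.
have sq1 t : 0 < 1 + t ^+ 2 by apply: ltr_pwDl; [exact: ltr01|exact: sqr_ge0].
have := sq1 s; have := sq1 (2 * al); have := sq1 al.
move=> /[dup] /lt0r_neq0 alN al0 /[dup] /lt0r_neq0 al2N al20 /[dup] /lt0r_neq0 sN s0.
have -> : 3 / 2 * ((2 * al - al) * (A + 2 * al * B)
     / ((1 + (2 * al) ^+ 2) * (1 + al ^+ 2)))
  = (3 / 2 * al) * ((A + 2 * al * B) / (1 + (2 * al) ^+ 2)) / (1 + al ^+ 2).
  by field; rewrite alN al2N.
have -> : (s - al) * (A + s * B) / ((1 + s ^+ 2) * (1 + al ^+ 2))
  = (s - al) * ((A + s * B) / (1 + s ^+ 2)) / (1 + al ^+ 2).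
  by field; rewrite alN sN.
have s1 : 0 <= s by lra.
have h1 : 0 <= s - 2 * al by lra.
have h2 : 0 <= s + 2 * al by lra.
have h3 : 0 <= 2 * al * s - 1.
  have h4 : 1 <= 2 * al by lra.
  by rewrite subr_ge0; apply: le_trans h4 _; rewrite ler_peMr//; lra.
apply: ler_wpM2r; first by rewrite invr_ge0 ltW.
apply: ler_pM; [lra| |lra|].
  by apply: divr_ge0; [apply: addr_ge0 => //; exact: mulr_ge0|exact: ltW].
rewrite ler_pdivrMr// mulrAC ler_pdivlMr// -subr_ge0.
have -> : (A + 2 * al * B) * (1 + s ^+ 2) - (A + s * B) * (1 + (2 * al) ^+ 2)
  = (s - 2 * al) * (A * (s + 2 * al) + B * (2 * al * s - 1)) by ring.
by apply: mulr_ge0 => //; apply: addr_ge0; apply: mulr_ge0.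
Qed.

(** The last hypothesis, that the slope [2 * al] grows at most as much as [(0, 1)], amounts to
    [4 * D * al <= F]. This makes both coefficients in the numerator of [sqr_growthB]
    nonnegative. *)
Lemma sqr_growth_concave p q al s : 0 <= p -> 0 <= q -> 1 <= al ->
  2 * al <= s -> s <= 5 / 2 * al ->
  sqr_growth p q (2 * al) <= (1 + p * q) ^+ 2 + q ^+ 2 ->
  sqr_growth p q s - sqr_growth p q al
  <= 3 / 2 * (sqr_growth p q (2 * al) - sqr_growth p q al).
Proof.
move=> p0 q0 al1 als sal rE; rewrite !sqr_growthB /=.
set F := q ^+ 2 + _ - 1 - _; set D := q + _.
have D0 : 0 <= D by rewrite addr_ge0 ?mulr_ge0 ?addr_ge0 ?mulr_ge0.
have Fal : 4 * D * al <= F.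
  move: rE; rewrite /sqr_growth ler_pdivrMr; last first.
    by apply: ltr_pwDl; [exact: ltr01|exact: sqr_ge0].
  rewrite -subr_ge0 => rE; rewrite -subr_ge0 (le_trans rE)//.
  by rewrite le_eqVlt; apply/orP; left; apply/eqP; rewrite /F /D; ring.
clearbody F D; move=> {p q p0 q0 rE}.
have al0 : 0 <= al by lra.
have Dal : 0 <= D * al by exact: mulr_ge0.
have F0 : 0 <= F by lra.
have Fal0 : 0 <= F * al by exact: mulr_ge0.
by apply: slope_quotient_concave => //; lra.
Qed.

(** Concavity of the square root: divide by [a + b] and use [c <= a], the other case being
    immediate. *)
Lemma concave_of_sqr (a b c : R) : 0 <= a -> 0 <= b -> b <= c ->
  a ^+ 2 - b ^+ 2 <= 3 / 2 * (c ^+ 2 - b ^+ 2) -> a - b <= 3 / 2 * (c - b).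
Proof.
move=> a0 b0 bc key.
have [ca|ac] := leP c a; last by lra.
have [a_eq0|a_neq0] := eqVneq a 0; first by lra.
have ab0 : 0 < a + b by apply: ltr_wpDr => //; rewrite lt_neqAle eq_sym a_neq0.
have ca0 : 0 <= (c - b) * (a - c) by apply: mulr_ge0; rewrite subr_ge0.
rewrite -(ler_pM2r ab0) -subr_ge0.
have -> : 3 / 2 * (c - b) * (a + b) - (a - b) * (a + b)
  = (3 / 2 * (c ^+ 2 - b ^+ 2) - (a ^+ 2 - b ^+ 2))
    + 3 / 2 * ((c - b) * (a - c)) by field.
by apply: addr_ge0; [rewrite subr_ge0|apply: mulr_ge0 => //; lra].
Qed.

(** For a function concave in the slope the factor would be [(s - al) / (2 * al - al)], which is at
    most [3 / 2]. *)
Lemma growth_concave k p q al s : 0 <= p -> 1 <= q -> 1 <= al ->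
  2 * al <= s -> s <= 5 / 2 * al ->
  growth k p q s - growth k p q al
  <= 3 / 2 * (growth k p q (2 * al) - growth k p q al).
Proof.
move=> p0 q1 al1 als sal.
have pq0 : 0 <= p * q by nra.
have al2 : al <= 2 * al by lra.
have mono := @growth_mono k p q al (2 * al) p0 q1 al1 al2.
case: k mono => /= mono; last by rewrite !subrr mulr0.
- have d0 : 0 <= q + p * q - p by nra.
  have E t : 0 < 1 + t -> (1 + p + (1 + q + p * q) * t) / (1 + t)
      = (1 + q + p * q) - (q + p * q - p) / (1 + t).
    by move=> t0; field; rewrite gt_eqF.
  rewrite !E; try lra.
  set d := q + p * q - p in d0 *.
  have -> : 1 + q + p * q - d / (1 + s) - (1 + q + p * q - d / (1 + al))
    = d * ((s - al) / ((1 + al) * (1 + s))).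
    by field; apply/andP; split; apply: lt0r_neq0; lra.
  have -> : 3 / 2 * (1 + q + p * q - d / (1 + 2 * al) - (1 + q + p * q - d / (1 + al)))
    = d * ((3 / 2 * al) / ((1 + al) * (1 + 2 * al))).
    by field; apply/andP; split; apply: lt0r_neq0; lra.
  apply: ler_wpM2l; first exact: d0.
  have a1 : 0 < 1 + al by lra.
  have s1 : 0 < 1 + s by lra.
  have a2 : 0 < 1 + 2 * al by lra.
  apply: ler_pM; [lra|by rewrite invr_ge0 ltW// mulr_gt0|lra|].
  rewrite lef_pV2 ?posrE ?mulr_gt0//.
  by rewrite ler_pM2l//; lra.
- set E := (1 + p * q) ^+ 2 + q ^+ 2; set r := sqr_growth p q.
  have r0 t : 0 <= r t by rewrite /r /sqr_growth divr_ge0 ?addr_ge0 ?sqr_ge0.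
  (* If the minimum at [2 * al] is already [Num.sqrt E], it cannot grow further and monotonicity
     suffices. Otherwise [sqr_growth_concave] applies. *)
  have [Er|rE] := leP E (r (2 * al)).
    have h := mono; rewrite -/E -/r in h.
    rewrite (min_idPl (ler_wsqrtr Er)) in h *.
    have : Num.min (Num.sqrt E) (Num.sqrt (r s)) <= Num.sqrt E by rewrite ge_min lexx.
    by move: h; lra.
  rewrite -/E -/r (min_idPr (ler_wsqrtr (ltW rE))) in mono.
  have zE : Num.sqrt (r (2 * al)) < Num.sqrt E.
    by rewrite ltr_sqrt//; exact: le_lt_trans rE.
  rewrite (min_idPr (ler_wsqrtr (ltW rE))).
  have yE : Num.min (Num.sqrt E) (Num.sqrt (r al)) = Num.sqrt (r al).
    apply/min_idPr; rewrite leNgt; apply/negP => h.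
    by move: mono; rewrite (min_idPl (ltW h)) leNgt zE.
  rewrite yE in mono *.
  have : Num.min (Num.sqrt E) (Num.sqrt (r s)) <= Num.sqrt (r s).
    by rewrite ge_min lexx orbT.
  suff : Num.sqrt (r s) - Num.sqrt (r al) <= 3 / 2 * (Num.sqrt (r (2 * al)) - Num.sqrt (r al)).
    by move=> h1 h2; apply: le_trans h1; rewrite lerD2r.
  apply: concave_of_sqr; rewrite ?sqrtr_ge0// !sqr_sqrtr//.
  by apply: sqr_growth_concave => //; [lra|exact: ltW].
Qed.

Lemma growth_ratio k p q al s : 0 <= p -> 1 <= q -> 1 <= al ->
  2 * al <= s -> s <= 5 / 2 * al ->
  growth k p q s <= 10 / 7 * growth k p q al.
Proof.
move=> p0 q1 al1 als sal.
have pq0 : 0 <= p * q by nra.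
case: k => /=; last by lra.
- rewrite mulrA ler_pdivrMr; last by lra.
  rewrite mulrAC ler_pdivlMr; last by lra.
  rewrite -subr_ge0.
  (* The last coefficient vanishes at [al = 1] and [s = 5 / 2]; this is where [10 / 7] comes
     from. *)
  have -> : 10 / 7 * (1 + p + (1 + q + p * q) * al) * (1 + s)
     - (1 + p + (1 + q + p * q) * s) * (1 + al)
    = (1 + p) * (10 / 7 * (1 + s) - (1 + al))
      + (1 + q + p * q) * (10 / 7 * al - s + 3 / 7 * (al * s)) by field.
  have h : s <= al * s by nra.
  by apply: addr_ge0; apply: mulr_ge0; lra.
- set E := (1 + p * q) ^+ 2 + q ^+ 2; set r := sqr_growth p q.
  have r0 t : 0 <= r t by rewrite /r /sqr_growth divr_ge0 ?addr_ge0 ?sqr_ge0.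
  have c0 : (0 : R) <= 10 / 7 by lra.
  rewrite minr_pMr// le_min; apply/andP; split.
    apply: (@le_trans _ _ (Num.sqrt E)); first by rewrite ge_min lexx.
    by apply: ler_peMl; [exact: sqrtr_ge0|lra].
  apply: (@le_trans _ _ (Num.sqrt (r s))); first by rewrite ge_min lexx orbT.
  rewrite -[10 / 7]ger0_norm// -sqrtr_sqr -sqrtrM ?sqr_ge0//; apply: ler_wsqrtr.
  rewrite /r /sqr_growth ler_pdivrMr; last by nra.
  rewrite mulrA mulrAC ler_pdivlMr; last by nra.
  rewrite -subr_ge0.
  have -> : (10 / 7) ^+ 2 * ((1 + q * al) ^+ 2 + (p + (1 + p * q) * al) ^+ 2) *
      (1 + s ^+ 2) - ((1 + q * s) ^+ 2 + (p + (1 + p * q) * s) ^+ 2) * (1 + al ^+ 2)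
    = (1 + p ^+ 2) * (100 / 49 * (1 + s ^+ 2) - (1 + al ^+ 2))
      + 2 * (q + p * (1 + p * q)) * (100 / 49 * al * (1 + s ^+ 2) - s * (1 + al ^+ 2))
      + (q ^+ 2 + (1 + p * q) ^+ 2) *
        (100 / 49 * al ^+ 2 * (1 + s ^+ 2) - s ^+ 2 * (1 + al ^+ 2)) by field.
  (* As [1 <= al <= s], the three coefficients are nonnegative even with 2 in place of
     [100 / 49]. *)
  have al2 : 1 <= al ^+ 2 by nra.
  have als2 : al ^+ 2 <= s ^+ 2 by nra.
  have h1 : 0 <= 100 / 49 * (1 + s ^+ 2) - (1 + al ^+ 2) by lra.
  have h2 : 0 <= 100 / 49 * al * (1 + s ^+ 2) - s * (1 + al ^+ 2).
    have : al * (al * s) <= s * (al * s) by apply: ler_wpM2r; nra.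
    have : s * 1 <= s * (al * al) by apply: ler_wpM2l; nra.
    by nra.
  have h3 : 0 <= 100 / 49 * al ^+ 2 * (1 + s ^+ 2) - s ^+ 2 * (1 + al ^+ 2).
    have : s ^+ 2 * 1 <= s ^+ 2 * al ^+ 2 by apply: ler_wpM2l; [exact: sqr_ge0|].
    by lra.
  have h4 : 0 <= 1 + p ^+ 2 by nra.
  have h5 : 0 <= 2 * (q + p * (1 + p * q)) by nra.
  have h6 : 0 <= q ^+ 2 + (1 + p * q) ^+ 2 by apply: addr_ge0; exact: sqr_ge0.
  by apply: addr_ge0; [apply: addr_ge0|]; apply: mulr_ge0.
Qed.

End Growth.

(** * From the three slopes of the theorem to the four slope classes *)

Section Classes.
Variable R : realType.
Implicit Types (p q u v s t x a b alpha beta : R) (k : norm_index) (w : R * R).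

(* A lower bound for the slope of the vectors [A y z v] with [v] positive, where
   [true] stands for A. *)
Definition class_slope alpha beta (y z : bool) : R :=
  match y, z with
  | true, true => 3 * alpha
  | true, false => 2 * alpha
  | false, true => alpha + alpha / (1 + alpha * beta)
  | false, false => alpha
  end.

(** For the Euclidean norm this is the operator norm of [A^a B^b], whose Gram matrix has determinant
    1 and trace [2 + C]. The other values are the growth of [(0, 1)] for [k_one] and of [(1, s)] for
    [k_infty]. *)
Definition growth_sup k p q s : R :=
  match k with
  | k_one => 1 + q + p * q
  | k_two => let C := (p + q) ^+ 2 + (p * q) ^+ 2 in
      Num.sqrt (1 / 2 * (2 + C + Num.sqrt (C * (C + 4))))
  | k_infty => 1 + p * q + p / s
  end.

Lemma growth_sup_ge k p q s u v : 1 <= p -> 1 <= q -> 1 <= s -> 0 < u -> s * u <= v ->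
  vnorm k (block_vec p q (u, v)) <= growth_sup k p q s * vnorm k (u, v).
Proof.
move=> p1 q1 s1 u0 suv.
have uv : u <= v by nra.
have v0 : 0 < v by lra.
have pq1 : p <= p * q by nra.
have pu0 : 0 < p * u by apply: mulr_gt0; lra.
case: k => /=.
- by nra.
- set C := (p + q) ^+ 2 + (p * q) ^+ 2.
  have C0 : 0 <= C by rewrite addr_ge0 ?sqr_ge0.
  set r := Num.sqrt (C * (C + 4)).
  have r0 : 0 <= r by exact: sqrtr_ge0.
  have rE : r ^+ 2 = C * (C + 4).
    by rewrite sqr_sqrtr//; apply: mulr_ge0 => //; lra.
  have mu0 : 0 <= 1 / 2 * (2 + C + r) by lra.
  rewrite -sqrtrM//; apply: ler_wsqrtr.
  set mu := 1 / 2 * _ in mu0 *.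
  (* [mu] is the largest eigenvalue of the Gram matrix of [A^a B^b]. Subtracting this matrix from
     [mu] times the identity leaves a singular matrix with entries [X], [Y] and [- B], so [X] times
     its quadratic form is a square. *)
  pose X := mu - (1 + p ^+ 2); pose Y := mu - (q ^+ 2 + (1 + p * q) ^+ 2).
  pose B := q + p * (1 + p * q).
  have XY : X * Y = B ^+ 2.
    have -> : X * Y = B ^+ 2 + (r ^+ 2 - C * (C + 4)) / 4.
      by rewrite /X /Y /B /mu /C; field.
    by rewrite rE; field.
  have XDY : X + Y = r by rewrite /X /Y /mu /C; field.
  have B0 : 0 < B by rewrite /B; nra.
  have X0 : 0 < X.
    have BB : 0 < X * Y by rewrite XY exprn_gt0.
    rewrite ltNge; apply/negP => X0; have Y0 : Y < 0 by nra.
    by lra.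
  rewrite -subr_ge0 -(pmulr_rge0 _ X0).
  have -> : X * (mu * (u ^+ 2 + v ^+ 2)
      - ((u + q * v) ^+ 2 + (p * u + (1 + p * q) * v) ^+ 2))
    = (X * u - B * v) ^+ 2 + (X * Y - B ^+ 2) * v ^+ 2 by rewrite /X /Y /B; ring.
  by rewrite XY subrr mul0r addr0 sqr_ge0.
- have pqv : q * v <= p * q * v by apply: ler_wpM2r; [exact: ltW|nra].
  have pu : u <= p * u by nra.
  rewrite (max_idPr uv) ge_max.
  have suff2 : p * u + (1 + p * q) * v <= (1 + p * q + p / s) * v.
    rewrite [leRHS]mulrDl addrC lerD2l mulrAC ler_pdivlMr; last by lra.
    by rewrite -mulrA ler_wpM2l//; lra.
  by rewrite suff2 andbT (le_trans _ suff2)//; lra.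
Qed.

Lemma growth_sup_gt0 k p q s : 1 <= p -> 1 <= q -> 1 <= s ->
  0 < growth_sup k p q s.
Proof.
move=> p1 q1 s1; have pq1 : 1 <= p * q by nra.
case: k => /=; first by lra.
- rewrite sqrtr_gt0; set C := _ + _ ^+ 2; set r := Num.sqrt _.
  have C0 : 0 <= C by rewrite addr_ge0 ?sqr_ge0.
  have r0 : 0 <= r by exact: sqrtr_ge0.
  by lra.
- have : 0 < p / s by apply: divr_gt0; lra.
  by lra.
Qed.

Lemma class_slope_ge1 alpha beta y z : 1 <= alpha -> 1 <= beta ->
  1 <= class_slope alpha beta y z.
Proof.
move=> a1 b1; case: y; case: z => /=; try lra.
have : 0 <= alpha / (1 + alpha * beta) by apply: divr_ge0; nra.
by lra.
Qed.

Definition third_slope alpha beta : R := 2 * alpha + alpha / (1 + alpha * beta).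

Lemma alpha_frac_bound alpha beta : 1 <= alpha -> 1 <= beta ->
  0 <= alpha / (1 + alpha * beta) <= alpha / 2.
Proof.
move=> a1 b1; have x1 : 1 <= alpha * beta by nra.
rewrite divr_ge0/=; try lra.
apply: ler_wpM2l; first by lra.
by rewrite lef_pV2 ?posrE; lra.
Qed.

Lemma phihatE k a b alpha beta : 1 <= alpha -> 1 <= beta ->
  [/\ phihat k 1 a b alpha beta = growth k (a * alpha) (b * beta) alpha,
      phihat k 2 a b alpha beta =
        growth k (a * alpha) (b * beta) (class_slope alpha beta false true)
    & phihat k 3 a b alpha beta =
        growth k (a * alpha) (b * beta) (third_slope alpha beta)].
Proof.
move=> al1 be1.
have x1 : 1 <= alpha * beta by nra.
have n1 : 1 + alpha != 0 by apply: lt0r_neq0; lra.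
have n2 : 1 + alpha * beta != 0 by apply: lt0r_neq0; lra.
have sqs t : 1 + t ^+ 2 != 0.
  by apply: lt0r_neq0; apply: ltr_pwDl; [exact: ltr01|exact: sqr_ge0].
have sq t : t != 0 -> forall t', t ^+ 2 + t' ^+ 2 != 0.
  move=> t0 t'; apply: lt0r_neq0; apply: ltr_pwDl; last exact: sqr_ge0.
  by rewrite exprn_even_gt0.
case: k => /=; rewrite /third_slope.
- split; first by field.
    have d0 : alpha * (alpha * beta + beta + 2) + 1 != 0 by apply: lt0r_neq0; nra.
    have d1 : 1 + alpha * beta + (alpha * (1 + alpha * beta) + alpha) != 0.
      by apply: lt0r_neq0; nra.
    by field; rewrite ?n2 ?d0 ?d1.
  have d0 : alpha * (2 * alpha * beta + beta + 3) + 1 != 0 by apply: lt0r_neq0; nra.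
  have d1 : 1 + alpha * beta + (2 * alpha * (1 + alpha * beta) + alpha) != 0.
    by apply: lt0r_neq0; nra.
  by field; rewrite ?n2 ?d0 ?d1.
- have E1 : (1 + a * alpha * b * beta) ^+ 2 + b ^+ 2 * beta ^+ 2
     = (1 + a * alpha * (b * beta)) ^+ 2 + (b * beta) ^+ 2 by ring.
  rewrite /phihat_two E1 /sqr_growth; split; congr (Num.min _ (Num.sqrt _)).
  + by field; rewrite sqs.
  + have d1 := sq _ n2 (alpha * (1 + alpha * beta) + alpha).
    by field; rewrite ?n2 /= d1.
  + have d1 := sq _ n2 (2 * alpha * (1 + alpha * beta) + alpha).
    by field; rewrite ?n2 /= d1.
- by rewrite /phihat_infty !mulrA; split.
Qed.

Lemma mean4_ln_le (y1 y2 y3 y4 m : R) : 0 < y1 -> 0 < y2 -> 0 < y3 -> 0 < y4 ->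
  0 < m -> y1 * y2 * y3 * y4 <= m ^+ 4 ->
  (ln y1 + ln y2 + ln y3 + ln y4) / 4 <= ln m.
Proof.
move=> h1 h2 h3 h4 m0 le.
have : ln (y1 * y2 * y3 * y4) <= ln (m ^+ 4).
  by rewrite ler_ln ?posrE ?exprn_gt0 ?mulr_gt0.
by rewrite lnXn// !lnM ?posrE ?mulr_gt0// -mulr_natr; lra.
Qed.

Lemma mean4_ln_ge (y1 y2 y3 y4 m : R) : 0 < y1 -> 0 < y2 -> 0 < y3 -> 0 < y4 ->
  0 < m -> m ^+ 4 <= y1 * y2 * y3 * y4 ->
  ln m <= (ln y1 + ln y2 + ln y3 + ln y4) / 4.
Proof.
move=> h1 h2 h3 h4 m0 le.
have : ln (m ^+ 4) <= ln (y1 * y2 * y3 * y4).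
  by rewrite ler_ln ?posrE ?exprn_gt0 ?mulr_gt0.
by rewrite lnXn// !lnM ?posrE ?mulr_gt0// -mulr_natr; lra.
Qed.

(** Two rounds of the inequality for two numbers. *)
Lemma prod4_le_pow4_mean (y1 y2 y3 y4 : R) : 0 <= y1 -> 0 <= y2 -> 0 <= y3 -> 0 <= y4 ->
  y1 * y2 * y3 * y4 <= ((y1 + y2 + y3 + y4) / 4) ^+ 4.
Proof.
move=> h1 h2 h3 h4.
have amgm s t : s * t <= ((s + t) / 2) ^+ 2.
  rewrite -subr_ge0.
  have -> : ((s + t) / 2) ^+ 2 - s * t = ((s - t) / 2) ^+ 2 by field.
  exact: sqr_ge0.
have -> : ((y1 + y2 + y3 + y4) / 4) ^+ 4
   = ((((y1 + y2) / 2 + (y3 + y4) / 2) / 2) ^+ 2) ^+ 2 by field.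
apply: (@le_trans _ _ ((((y1 + y2) / 2) * ((y3 + y4) / 2)) ^+ 2)).
  by rewrite exprMn -mulrA; apply: ler_pM; rewrite ?mulr_ge0.
have h12 : 0 <= (y1 + y2) / 2 by lra.
have h34 : 0 <= (y3 + y4) / 2 by lra.
have ? := mulr_ge0 h12 h34.
by rewrite lerXn2r// nnegrE sqr_ge0.
Qed.

Lemma sum3E (f : nat -> R) : \sum_(1 <= m < 4) f m = f 1%N + f 2%N + f 3%N.
Proof. by rewrite unlock /= addr0 addrA. Qed.

Lemma ln_phihat_le k a b alpha beta : 1 <= a -> 1 <= b -> 1 <= alpha -> 1 <= beta ->
  let g y z := ln (growth k (a * alpha) (b * beta) (class_slope alpha beta y z)) in
  ln (3^-1 * \sum_(1 <= m < 4) phihat k m a b alpha beta)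
  <= (g true true + g true false + g false true + g false false) / 4.
Proof.
move=> a1 b1 al1 be1 /=.
have [/= c0 c2] := andP (alpha_frac_bound al1 be1).
have [p1 p2 p3] := phihatE k a b al1 be1.
rewrite sum3E p1 p2 p3 /third_slope /=.
have p0 : 0 <= a * alpha by nra.
have q1 : 1 <= b * beta by nra.
have gt0 s : 1 <= s -> 0 < growth k (a * alpha) (b * beta) s by exact: growth_gt0.
have mono s t : 1 <= s -> s <= t ->
   growth k (a * alpha) (b * beta) s <= growth k (a * alpha) (b * beta) t.
  by exact: growth_mono.
set G := growth k (a * alpha) (b * beta) in gt0 mono *.
have g1 := gt0 alpha al1.
have g3 := gt0 (2 * alpha + alpha / (1 + alpha * beta)).
set s2 := alpha + _ in p2 *; set s3 := 2 * alpha + _ in g3 *.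
apply: mean4_ln_ge; try (apply: gt0; rewrite /s2; lra).
  by rewrite mulr_gt0 ?invr_gt0// !addr_gt0// gt0// /s2 /s3; lra.
rewrite [3^-1 * _](_ : _ = (G alpha + G s2 + G s3) / 3); last by rewrite mulrC.
(* The slope [3 * alpha] is lowered to [s3], which is at most [5 / 2 * alpha] as [growth_concave]
   and [growth_ratio] require. *)
apply: (@le_trans _ _ (G alpha * G s2 * G (2 * alpha) * G s3)).
  apply: pow4_mean_le_prod => //.
  - by apply: mono; rewrite /s2; lra.
  - by apply: mono; rewrite /s2; lra.
  - by apply: mono; rewrite /s3; lra.
  - by apply: growth_concave => //; rewrite /s3; lra.
  - by apply: growth_ratio => //; rewrite /s3; lra.
rewrite [leRHS](_ : _ = G alpha * G s2 * G (2 * alpha) * G (3 * alpha)); last by ring.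
apply: ler_wpM2l; last by apply: mono; rewrite /s3; lra.
by rewrite !mulr_ge0// ltW// gt0// /s2; lra.
Qed.

Lemma ln_psihat_ge k a b alpha beta : 1 <= a -> 1 <= b -> 1 <= alpha -> 1 <= beta ->
  let g y z := ln (growth_sup k (a * alpha) (b * beta) (class_slope alpha beta y z)) in
  (g true true + g true false + g false true + g false false) / 4
  <= ln (3^-1 * \sum_(1 <= m < 4) psihat k m a b alpha beta).
Proof.
move=> a1 b1 al1 be1 /=.
have p1 : 1 <= a * alpha by nra.
have q1 : 1 <= b * beta by nra.
set G := growth_sup k (a * alpha) (b * beta).
have gt0 y z : 0 < G (class_slope alpha beta y z).
  by apply: growth_sup_gt0 => //; exact: class_slope_ge1.
set M := 3^-1 * _.
have meanM : (G (class_slope alpha beta true true) + G (class_slope alpha beta true false)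
   + G (class_slope alpha beta false true) + G (class_slope alpha beta false false)) / 4 <= M.
  rewrite /M sum3E /G.
  case: (k) => /=.
  - by rewrite /psihat_one !mulrA; lra.
  - rewrite /psihat_two /calC.
    have -> : a * alpha * b * beta = a * alpha * (b * beta) by ring.
    by move: (Num.sqrt (1 / 2 * _)) => t; lra.
  - rewrite !mulrA.
    have x1 : 1 <= alpha * beta by nra.
    have -> : a * alpha / (3 * alpha) = a / 3.
      by field; apply: lt0r_neq0; lra.
    have -> : a * alpha / (2 * alpha) = a / 2.
      by field; apply: lt0r_neq0; lra.
    have -> : a * alpha / alpha = a.
      by field; apply: lt0r_neq0; lra.
    have -> : a * alpha / (alpha + alpha / (1 + alpha * beta))
       = a * ((1 + alpha * beta) / (2 + alpha * beta)).
      by field; rewrite !lt0r_neq0//; nra.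
    rewrite -!(mulrA a).
    have -> : 3 + 2 * alpha * beta = 3 + 2 * (alpha * beta) by ring.
    move: (alpha * beta) x1 => x x1.
    (* Both quotients increase with [x]; the bounds are their values at [x = 1]. *)
    have h1 : 2 / 3 <= (1 + x) / (2 + x) by rewrite ler_pdivlMr; lra.
    have h2 : 2 / 5 <= (1 + x) / (3 + 2 * x) by rewrite ler_pdivlMr; lra.
    move: ((1 + x) / _) h1 ((1 + x) / _) h2 => y hy z hz.
    by nra.
apply: (mean4_ln_le (gt0 true true) (gt0 true false) (gt0 false true) (gt0 false false)).
  by apply: (lt_le_trans _ meanM); rewrite divr_gt0// !addr_gt0.
apply: le_trans (prod4_le_pow4_mean _ _ _ _) _; try exact: ltW.
have h0 : 0 <= (G (class_slope alpha beta true true) + G (class_slope alpha beta true false)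
   + G (class_slope alpha beta false true) + G (class_slope alpha beta false false)) / 4.
  by rewrite divr_ge0 ?addr_ge0 ?ltW.
by rewrite lerXn2r// nnegrE// (le_trans h0).
Qed.

End Classes.

(** * The vectors produced by words, and the block bounds for their norms *)

Section WordVec.
Variables (R : realType) (alpha beta : R).
Hypotheses (al1 : 1 <= alpha) (be1 : 1 <= beta).
Implicit Types (k : norm_index) (w : R * R) (s t : seq bool).

Definition shear_vec (x : bool) w : R * R :=
  if x then (w.1, alpha * w.1 + w.2) else (w.1 + beta * w.2, w.2).

(** Starting from [(1, 1)] makes the coordinates the row sums of the matrix product. *)
Definition word_vec s : R * R := foldr shear_vec (1, 1) s.

Lemma word_vec_ge1 s : 1 <= (word_vec s).1 /\ 1 <= (word_vec s).2.
Proof.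
elim: s => [|[] s [IH1 IH2]] /=; first by split.
- by split=> //; have := mulr_ge0 (le_trans ler01 al1) (le_trans ler01 IH1); lra.
- by split=> //; have := mulr_ge0 (le_trans ler01 be1) (le_trans ler01 IH2); lra.
Qed.

Lemma word_vec_block a b t : word_vec (nseq a true ++ nseq b false ++ t) =
  block_vec (a%:R * alpha) (b%:R * beta) (word_vec t).
Proof.
elim: a => [|a IH] /=.
  elim: b => [|b IH] /=.
    by case: (word_vec t) => u v; rewrite /block_vec /=; congr (_, _); ring.
  by rewrite IH /block_vec /shear_vec /=; congr (_, _); rewrite -?natr1; ring.
by rewrite IH /block_vec /shear_vec /=; congr (_, _); rewrite -?natr1; ring.
Qed.

(** The leading A adds [alpha] to the slope, so it remains to bound the slope after [z] and then [y]
    have acted on a positive vector. *)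
Lemma word_vec_slope y z s : class_slope alpha beta y z *
  (word_vec [:: true, y, z & s]).1 <= (word_vec [:: true, y, z & s]).2.
Proof.
have a1 := al1; have b1 := be1.
have [] := word_vec_ge1 s; rewrite /=.
move: (word_vec s) => [u v] /= u1 v1.
have x1 : 1 <= alpha * beta by nra.
have n0 : 0 < 1 + alpha * beta by lra.
clear a1 b1; case: y; case: z => /=; [lra|lra| |lra].
rewrite mulrDl lerD2l mulrAC ler_pdivrMr//; lra.
Qed.

(** The crude factor [1 + alpha + beta] serves both letters and all three norms; its logarithm is
    the weight of a letter in [log_defect]. *)
Lemma vnorm_shear k x w : 0 <= w.1 -> 0 <= w.2 ->
  vnorm k w <= vnorm k (shear_vec x w) <= (1 + alpha + beta) * vnorm k w.
Proof.
have al0 : 0 <= alpha by exact: le_trans al1.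
have be0 : 0 <= beta by exact: le_trans be1.
have c0 : 0 <= 1 + alpha + beta by rewrite !addr_ge0.
case: w => u v /= u0 v0.
have au0 : 0 <= alpha * u by exact: mulr_ge0.
have bv0 : 0 <= beta * v by exact: mulr_ge0.
have av0 : 0 <= alpha * v by exact: mulr_ge0.
have bu0 : 0 <= beta * u by exact: mulr_ge0.
case: k => /=.
- by case: x => /=; apply/andP; split; lra.
- have shear (t y z : R) : 0 <= t -> 0 <= y -> 0 <= z -> 1 + t <= 1 + alpha + beta ->
      Num.sqrt (z ^+ 2 + y ^+ 2) <= Num.sqrt (z ^+ 2 + (t * z + y) ^+ 2)
      <= (1 + alpha + beta) * Num.sqrt (z ^+ 2 + y ^+ 2).
    move=> t0 y0 z0 tc; have tz0 : 0 <= t * z by exact: mulr_ge0.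
    apply/andP; split.
      apply: ler_wsqrtr; rewrite lerD2l.
      by rewrite lerXn2r ?nnegrE ?addr_ge0// lerDr.
    apply: (@le_trans _ _ ((1 + t) * Num.sqrt (z ^+ 2 + y ^+ 2))); last first.
      by rewrite ler_wpM2r ?sqrtr_ge0.
    have t1 : 0 <= 1 + t by rewrite addr_ge0.
    rewrite -[1 + t]ger0_norm// -sqrtr_sqr -sqrtrM ?sqr_ge0//; apply: ler_wsqrtr.
    rewrite -subr_ge0.
    have -> : (1 + t) ^+ 2 * (z ^+ 2 + y ^+ 2) - (z ^+ 2 + (t * z + y) ^+ 2)
      = t * ((z - y) ^+ 2 + z ^+ 2 + y ^+ 2) + (t * y) ^+ 2 by ring.
    by rewrite addr_ge0 ?sqr_ge0// mulr_ge0// !addr_ge0 ?sqr_ge0.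
  case: x => /=; first by apply: shear => //; rewrite lerDl.
  rewrite [u ^+ 2 + _]addrC [_ + v ^+ 2]addrC [u + _]addrC.
  by apply: shear => //; rewrite -addrA lerD2l lerDr.
- set m := Num.max u v.
  have um : u <= m by rewrite le_max lexx.
  have vm : v <= m by rewrite le_max lexx orbT.
  have m0 : 0 <= m by exact: le_trans um.
  have -> : (1 + alpha + beta) * m = m + alpha * m + beta * m by ring.
  have am : alpha * u <= alpha * m by exact: ler_wpM2l.
  have bm : beta * v <= beta * m by exact: ler_wpM2l.
  have am0 : 0 <= alpha * m by exact: mulr_ge0.
  have bm0 : 0 <= beta * m by exact: mulr_ge0.
  rewrite /m; case: x => /=; rewrite !ge_max -/m !le_max !lexx /= ?orbT.
    by rewrite lerDr au0 orbT /=; apply/andP; split; lra.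
  by rewrite lerDl bv0 /=; apply/andP; split; lra.
Qed.

Lemma vnorm_equiv k w : 0 <= w.1 -> 0 <= w.2 ->
  2^-1 * (w.1 + w.2) <= vnorm k w <= w.1 + w.2.
Proof.
case: w => u v /= u0 v0; case: k => /=.
- by apply/andP; split; lra.
- have -> : u + v = Num.sqrt ((u + v) ^+ 2) by rewrite sqrtr_sqr ger0_norm// addr_ge0.
  have uv0 : 0 <= u * v by nra.
  apply/andP; split; last by apply: ler_wsqrtr; nra.
  have h0 : (0 : R) <= 2^-1 by lra.
  rewrite -[2^-1]ger0_norm// -sqrtr_sqr -sqrtrM ?sqr_ge0//; apply: ler_wsqrtr.
  have := sqr_ge0 (u - v); rewrite !expr2; nra.
- rewrite le_max ge_max; apply/andP; split; last by apply/andP; split; lra.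
  by have [uv|/ltW uv] := leP u v; apply/orP; [right|left]; lra.
Qed.

Definition log_vnorm k s : R := ln (vnorm k (word_vec s)).

Lemma vnorm_word_gt0 k s : 0 < vnorm k (word_vec s).
Proof.
have a1 := al1; have b1 := be1.
have [h1 h2] := word_vec_ge1 s.
have /andP[] := @vnorm_equiv k (word_vec s) ltac:(lra) ltac:(lra).
by move=> + _; apply: lt_le_trans; lra.
Qed.

Lemma log_vnorm_mono k x s : log_vnorm k s <= log_vnorm k (x :: s).
Proof.
have a1 := al1; have b1 := be1.
have [h1 h2] := word_vec_ge1 s.
rewrite ler_ln ?posrE ?vnorm_word_gt0//=.
by have /andP[] := @vnorm_shear k x (word_vec s) ltac:(lra) ltac:(lra).
Qed.

Lemma log_vnorm_le_cat k u s : log_vnorm k s <= log_vnorm k (u ++ s).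
Proof. by elim: u => //= x u IH; exact: le_trans IH (log_vnorm_mono _ _ _). Qed.

Lemma log_vnorm_step k x s :
  log_vnorm k (x :: s) <= ln (1 + alpha + beta) + log_vnorm k s.
Proof.
have a1 := al1; have b1 := be1.
have [h1 h2] := word_vec_ge1 s.
rewrite -lnM ?posrE ?vnorm_word_gt0//; last by lra.
rewrite ler_ln ?posrE ?mulr_gt0 ?vnorm_word_gt0//=; last by lra.
by have /andP[] := @vnorm_shear k x (word_vec s) ltac:(lra) ltac:(lra).
Qed.

(* Truncating at 0 is harmless because [log_vnorm] and [log_defect] are monotone
   in the word. *)
Definition gain_lower k (y z : bool) (a b : nat) : R := Num.max 0
  (ln (growth k (a%:R * alpha) (b%:R * beta) (class_slope alpha beta y z))).

Definition gain_upper k (y z : bool) (a b : nat) : R := Num.max 0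
  (ln (1 + alpha + beta) * (a + b)%:R
   - ln (growth_sup k (a%:R * alpha) (b%:R * beta) (class_slope alpha beta y z))).

Let mul_ge1 (a : nat) (t : R) : (0 < a)%N -> 1 <= t -> 1 <= a%:R * t.
Proof.
move=> a0 t1; have : (1 : R) <= a%:R by rewrite ler1n.
by move: (a%:R) => {a0}r r1; nra.
Qed.

Lemma gain_lower_bounded k : block_bounded (log_vnorm k) (gain_lower k).
Proof.
have a1 := al1; have b1 := be1.
move=> a b y z s a0 b0 /=; set t := [:: true, y, z & s].
have [h1 h2] := word_vec_ge1 t.
have [p1 q1] := (mul_ge1 a0 al1, mul_ge1 b0 be1).
rewrite /gain_lower maxEle; case: ifPn => [_|_]; last first.
  by rewrite addr0 catA; exact: log_vnorm_le_cat.
have g0 : 0 < growth k (a%:R * alpha) (b%:R * beta) (class_slope alpha beta y z).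
  by apply: growth_gt0; [lra|lra|exact: class_slope_ge1].
rewrite /log_vnorm addrC -lnM ?posrE ?vnorm_word_gt0//.
rewrite ler_ln ?posrE ?mulr_gt0 ?vnorm_word_gt0// word_vec_block.
rewrite [word_vec t]surjective_pairing.
apply: growth_le; [lra|lra|exact: class_slope_ge1|lra|exact: word_vec_slope].
Qed.

Lemma log_vnorm_cat k u s :
  log_vnorm k (u ++ s) <= ln (1 + alpha + beta) * (size u)%:R + log_vnorm k s.
Proof.
elim: u => [|x u IH]; first by rewrite mulr0 add0r.
have := log_vnorm_step k x (u ++ s).
by rewrite /= -natr1 mulrDr mulr1; move: IH; lra.
Qed.

Definition log_defect k s : R := ln (1 + alpha + beta) * (size s)%:R - log_vnorm k s.

Lemma log_defect_cat k u s : log_defect k s <= log_defect k (u ++ s).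
Proof.
have := log_vnorm_cat k u s.
by rewrite /log_defect size_cat natrD mulrDr; lra.
Qed.

Lemma gain_upper_bounded k : block_bounded (log_defect k) (gain_upper k).
Proof.
have a1 := al1; have b1 := be1.
move=> a b y z s a0 b0 /=; set t := [:: true, y, z & s].
have [h1 h2] := word_vec_ge1 t.
have [p1 q1] := (mul_ge1 a0 al1, mul_ge1 b0 be1).
rewrite /gain_upper maxEle; case: ifPn => [_|_]; last first.
  by rewrite addr0 catA; exact: log_defect_cat.
have g0 : 0 < growth_sup k (a%:R * alpha) (b%:R * beta) (class_slope alpha beta y z).
  by apply: growth_sup_gt0; [lra|lra|exact: class_slope_ge1].
have : log_vnorm k (nseq a true ++ nseq b false ++ t) <=
   ln (growth_sup k (a%:R * alpha) (b%:R * beta) (class_slope alpha beta y z))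
    + log_vnorm k t.
  rewrite /log_vnorm -lnM ?posrE ?vnorm_word_gt0//.
  rewrite ler_ln ?posrE ?mulr_gt0 ?vnorm_word_gt0// word_vec_block.
  rewrite [word_vec t]surjective_pairing.
  apply: growth_sup_ge; [lra|lra|exact: class_slope_ge1|lra|exact: word_vec_slope].
rewrite /log_defect !size_cat !size_nseq !natrD !mulrDr; lra.
Qed.

Lemma le_class_mean (D : bool -> bool -> nat -> nat -> R) (g : bool -> bool -> R) a b :
  (forall y z, g y z <= D y z a b) ->
  (g true true + g true false + g false true + g false false) / 4 <= class_mean D a b.
Proof.
move=> gD; rewrite /class_mean.
have := gD true true; have := gD true false; have := gD false true.
have := gD false false; lra.
Qed.

Lemma lower_rate k K (l : R) :
  word_mean n (log_vnorm k) / n%:R @[n --> \oo] --> l ->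
  \sum_(1 <= a < K.+1) \sum_(1 <= b < K.+1) 2^-1 ^+ (a + b) *
    ln (3^-1 * \sum_(1 <= m < 4) phihat k m a%:R b%:R alpha beta) <= 4 * l.
Proof.
move=> cvl.
apply: le_trans (block_sum_le_rate K (log_vnorm_mono k) (@gain_lower_bounded k) _ cvl); last first.
  by move=> *; rewrite le_max lexx.
apply: ler_sum_nat => a /andP[a0 _]; apply: ler_sum_nat => b /andP[b0 _].
apply: ler_wpM2l; first by rewrite exprn_ge0// invr_ge0.
apply: le_trans (ln_phihat_le _ _ _ _ _) _; rewrite ?ler1n//.
by apply: (@le_class_mean (gain_lower k)
  (fun y z => ln (growth k (a%:R * alpha) (b%:R * beta) (class_slope alpha beta y z)))) => y z;
  rewrite le_max lexx orbT.
Qed.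

(** The sum of [2^-1 ^+ (a + b) * (a + b)%:R] tends to 4 as [K] grows, so the terms in
    [ln (1 + alpha + beta)] cancel in the limit and leave an upper bound for [4 * l]. *)
Lemma upper_rate k K (l : R) :
  word_mean n (log_vnorm k) / n%:R @[n --> \oo] --> l ->
  \sum_(1 <= a < K.+1) \sum_(1 <= b < K.+1) 2^-1 ^+ (a + b) *
    (ln (1 + alpha + beta) * (a + b)%:R -
     ln (3^-1 * \sum_(1 <= m < 4) psihat k m a%:R b%:R alpha beta))
  <= 4 * (ln (1 + alpha + beta) - l).
Proof.
move=> cvl.
have cvd : word_mean n (log_defect k) / n%:R @[n --> \oo] --> (ln (1 + alpha + beta) - l).
  have : ln (1 + alpha + beta) - word_mean n (log_vnorm k) / n%:R @[n --> \oo]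
     --> ln (1 + alpha + beta) - l by apply: cvgB => //; exact: cvg_cst.
  apply: cvg_trans; apply: near_eq_cvg; near=> n.
  have n0 : n%:R != 0 :> R by rewrite pnatr_eq0 -lt0n; near: n; exact: nbhs_infty_gt.
  rewrite (@eq_word_mean _ n (log_defect k)
    (fun s => ln (1 + alpha + beta) * n%:R - log_vnorm k s)).
    by rewrite word_meanB word_mean_cst mulrBl mulfK.
  by move=> s sn; rewrite /log_defect sn.
have defect_mono x s : log_defect k s <= log_defect k (x :: s).
  exact: (log_defect_cat k [:: x] s).
apply: le_trans (block_sum_le_rate K defect_mono (@gain_upper_bounded k) _ cvd); last first.
  by move=> *; rewrite le_max lexx.
apply: ler_sum_nat => a /andP[a0 _]; apply: ler_sum_nat => b /andP[b0 _].
apply: ler_wpM2l; first by rewrite exprn_ge0// invr_ge0.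
have a1 : (1 : R) <= a%:R by rewrite ler1n.
have b1 : (1 : R) <= b%:R by rewrite ler1n.
have /= h := ln_psihat_ge k a1 b1 al1 be1.
pose g y z := ln (1 + alpha + beta) * (a + b)%:R -
  ln (growth_sup k (a%:R * alpha) (b%:R * beta) (class_slope alpha beta y z)).
have gD y z : g y z <= gain_upper k y z a b by rewrite le_max lexx orbT.
by apply: le_trans (le_class_mean gD); move: h; rewrite /g /=; lra.
Unshelve. all: by end_near. Qed.

End WordVec.

(** * Equivalence of norms in finite dimension *)

Section NormEquiv.
Variable R : realType.

Lemma is_norm_ge0 (V : lmodType R) (nu : V -> R) : is_norm nu ->
  nu 0 = 0 /\ forall x, 0 <= nu x.
Proof.
move=> [nuD nuZ _].
have nu0 : nu 0 = 0 by have := nuZ 0 0; rewrite scale0r normr0 mul0r.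
split=> // x; have := nuD x (- x).
have -> : nu (- x) = nu x by have := nuZ (-1) x; rewrite scaleN1r normrN1 mul1r.
by rewrite subrr nu0; lra.
Qed.

Lemma is_norm_sum (V : lmodType R) (nu : V -> R) (I : Type) (r : seq I) (F : I -> V) :
  is_norm nu -> nu (\sum_(i <- r) F i) <= \sum_(i <- r) nu (F i).
Proof.
move=> nun; have [nuD nuZ _] := nun; have [nu0 _] := is_norm_ge0 nun.
elim/big_rec2 : _ => [|i y x _ h]; first by rewrite nu0.
by apply: le_trans (nuD _ _) _; rewrite lerD2l.
Qed.

Lemma ler_norm_coord m n (u : 'M[R]_(m, n)) i j : `|u i j| <= `|u|.
Proof.
rewrite [leRHS]/Num.Def.normr /= mx_normrE.
by apply/bigmax_geP; right => /=; exists (i, j).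
Qed.

(** [nu] is Lipschitz, hence attains a minimum on the compact unit sphere, and this minimum is
    positive by definiteness. *)
Lemma row_norm_lower n (nu : 'rV[R]_n -> R) : is_norm nu ->
  exists2 c : R, 0 < c & forall u, c * `|u| <= nu u.
Proof.
move=> nun; have [nuD nuZ nuI] := nun; have [nu0 nu_ge0] := is_norm_ge0 nun.
pose C : R := \sum_(j < n) nu (delta_mx 0 j).
have upper u : nu u <= C * `|u|.
  rewrite {1}(row_sum_delta u) (le_trans (is_norm_sum _ _ nun))//.
  rewrite /C mulr_suml; apply: ler_sum => j _.
  by rewrite nuZ mulrC ler_wpM2l// ler_norm_coord.
have C0 : 0 <= C by apply: sumr_ge0.
have nu_cont : continuous nu.
  move=> u; apply/(@cvgrPdist_lt _ _ _ (nbhs u) (nbhs_filter u)) => e e0.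
  have C1 : 0 < C + 1 by lra.
  have e1 : 0 < e / (C + 1) by exact: divr_gt0.
  have near_u : nbhs u [set v | `|u - v| < e / (C + 1)]%classic.
    by have := nbhsx_ballx u _ e1; rewrite -ball_normE.
  apply: (@filterS _ (nbhs u) (nbhs_filter u) _ _ _ near_u) => v /= uv.
  have h1 : nu u <= nu v + nu (u - v) by rewrite -{1}(subrKC v u); exact: nuD.
  have h2 : nu v <= nu u + nu (v - u) by rewrite -{1}(subrKC u v); exact: nuD.
  have h3 : nu (v - u) = nu (u - v).
    by rewrite -opprB -scaleN1r nuZ normrN1 mul1r.
  have h4 : `|nu u - nu v| <= nu (u - v) by rewrite ler_norml; lra.
  apply: le_lt_trans h4 _; apply: le_lt_trans (upper _) _.
  apply: (@le_lt_trans _ _ ((C + 1) * `|u - v|)).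
    by rewrite ler_wpM2r// lerDl.
  by rewrite mulrC -ltr_pdivlMr.
pose S := [set u : 'rV[R]_n | `|u| = 1]%classic.
have Scl : closed S.
  apply: (@closed_comp _ _ (fun u : 'rV[R]_n => `|u|) [set 1]%classic).
    by move=> x _; exact: norm_continuous.
  exact: closed_eq.
have Sbd : bounded_set S.
  by exists 1; split => // M M1 u /= ->; exact: ltW.
have unit u : u != 0 -> S (`|u|^-1 *: u).
  by move=> u0; rewrite /S /= normrZ normrV ?unitfE ?normr_eq0// normr_id mulVf ?normr_eq0.
(* An empty sphere leaves only the vector 0, for which any constant works. *)
have [[u0 Su0]|S0] := pselect (S !=set0); last first.
  exists 1 => // u; have [->|/unit Su] := eqVneq u 0.
    by rewrite normr0 mulr0 nu0.
  by case: S0; eexists; exact: Su.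
have [|c Sc cmin] := @EVT_min_rV R n nu S (ex_intro _ u0 Su0) (bounded_closed_compact Sbd Scl).
  exact: continuous_subspaceT.
rewrite inE in Sc.
exists (nu c).
  rewrite lt_neqAle nu_ge0 andbT eq_sym; apply/eqP => /nuI c0.
  by move: Sc; rewrite /S /= c0 normr0 => /eqP; rewrite eq_sym oner_eq0.
move=> u; have [->|u0'] := eqVneq u 0; first by rewrite normr0 mulr0 nu0.
have := cmin _ (mem_set (unit _ u0')).
by rewrite nuZ normrV ?unitfE ?normr_eq0// normr_id mulrC ler_pdivlMr// normr_gt0.
Qed.

Lemma mx_norm_equiv m n (nu : 'M[R]_(m, n) -> R) : is_norm nu ->
  exists c C : R, [/\ 0 < c, 0 < C, forall (M : 'M[R]_(m, n)) i j, c * `|M i j| <= nu M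
    & forall M : 'M[R]_(m, n), nu M <= C * \sum_i \sum_j `|M i j|].
Proof.
move=> nun; have [nuD nuZ nuI] := nun; have [nu0 nu_ge0] := is_norm_ge0 nun.
have [|c c0 hc] := @row_norm_lower _ (fun u => nu (vec_mx u)).
  split => [x y|a x|x /nuI /eqP]; first by rewrite linearD.
    by rewrite linearZ nuZ.
  by rewrite vec_mx_eq0 => /eqP.
pose C : R := 1 + \sum_i \sum_j nu (delta_mx i j).
have s0 : 0 <= \sum_i \sum_j nu (delta_mx i j).
  by apply: sumr_ge0 => i _; apply: sumr_ge0.
exists c, C; split => //; first by rewrite /C; lra.
  move=> M i j; have := hc (mxvec M); rewrite mxvecK; apply: le_trans.
  by apply: ler_wpM2l; [exact: ltW|rewrite -mxvecE; exact: ler_norm_coord].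
move=> M; rewrite {1}(matrix_sum_delta M).
apply: le_trans (is_norm_sum _ _ nun) _.
rewrite mulr_sumr; apply: ler_sum => i _.
apply: le_trans (is_norm_sum _ _ nun) _.
rewrite mulr_sumr; apply: ler_sum => j _.
rewrite nuZ mulrC ler_wpM2r// /C (bigD1 i)//= (bigD1 j)//=.
have : 0 <= \sum_(i0 < m | i0 != i) \sum_j nu (delta_mx i0 j).
  by apply: sumr_ge0 => i' _; apply: sumr_ge0.
have : 0 <= \sum_(i0 < n | i0 != j) nu (delta_mx i i0) by apply: sumr_ge0.
by lra.
Qed.
End NormEquiv.

(** * Matrix products along words *)

Section WordMatrix.
Variables (R : realType) (alpha beta : R).
Implicit Types (s : seq bool) (x : bool).

Definition word_mx s : 'M[R]_2 :=
  foldr (fun (x : bool) M => (if x then shearA alpha else shearB beta) *m M) 1%:M s.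

Lemma prod_mkseq (N : nat) (x : nat -> bool) :
  \prod_(k < N) (if x k then shearA alpha else shearB beta) = word_mx (mkseq x N).
Proof.
elim: N x => [|N IH] x; first by rewrite big_ord0.
rewrite big_ord_recl (IH (fun k => x k.+1)) /mkseq /=.
by rewrite (iotaDl 1 0 N) -map_comp.
Qed.

Hypotheses (al0 : 0 <= alpha) (be0 : 0 <= beta).

Lemma word_mx_ge0 s i j : 0 <= word_mx s i j.
Proof.
elim: s i j => [|x s IH] i j /=; first by rewrite mxE ler0n.
rewrite mxE; apply: sumr_ge0 => k _; apply: mulr_ge0 => //.
by case: x; rewrite mxE; do 2?case: ifP.
Qed.

Lemma word_mx_row s i : \sum_j word_mx s i j =
  if i == 0 then (word_vec alpha beta s).1 else (word_vec alpha beta s).2.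
Proof.
elim: s i => [|x s IH] i /=.
  rewrite big_ord_recl big_ord1 !mxE.
  by case: i => -[|[|//]] i2 /=; rewrite ?addr0 ?add0r.
under eq_bigr do rewrite mxE.
rewrite exchange_big /=; under eq_bigr do rewrite -mulr_sumr IH.
rewrite big_ord_recl big_ord1 /=.
by case: i => -[|[|//]] i2; case: x; rewrite !mxE /=; ring.
Qed.

(** The entries are nonnegative, so their sum is the sum of the row sums; this links matrix norms to
    [word_vec]. *)
Lemma word_mx_sum s : \sum_i \sum_j `|word_mx s i j| =
  vnorm k_one (word_vec alpha beta s).
Proof.
under eq_bigr do under eq_bigr do rewrite ger0_norm ?word_mx_ge0//.
by under eq_bigr do rewrite word_mx_row; rewrite big_ord_recl big_ord1.
Qed.
End WordMatrix.

(** * Expectations over coin flips as averages over words *)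

Section Expectation.
Context d (T : measurableType d) (R : realType) (P : probability T R).
Variable X : nat -> {RV P >-> bool}.
Hypothesis flips : fair_coin_flips X.

Fixpoint words N : seq (seq bool) :=
  if N is N'.+1 then map (cons true) (words N') ++ map (cons false) (words N')
  else [:: [::]].

Lemma size_words N s : s \in words N -> size s = N.
Proof.
elim: N s => [|N IH] s /=; first by rewrite inE => /eqP ->.
by rewrite mem_cat => /orP[] /mapP[t /IH tN ->] /=; rewrite tN.
Qed.

Lemma word_mean_words N (f : seq bool -> R) :
  word_mean N f = \sum_(s <- words N) f s * 2^-1 ^+ N.
Proof.
elim: N f => [|N IH] f /=; first by rewrite big_seq1 expr0 mulr1.
rewrite big_cat !big_map !IH mulrDl !mulr_suml /=.
by congr (_ + _); apply: eq_bigr => s _; rewrite exprSr mulrA.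
Qed.

(** Writes a function of the random word as a finite combination of indicators, whose integrals are
    known. *)
Lemma sum_words_eq N (f : seq bool -> R) t : size t = N ->
  \sum_(s <- words N) f s * (t == s)%:R = f t.
Proof.
elim: N f t => [|N IH] f [|b t] //=; first by rewrite big_seq1 eqxx mulr1.
move=> [/IH tN]; rewrite big_cat !big_map /=.
have cons_neq c : c != b -> \sum_(s <- words N) f (c :: s) * (b :: t == c :: s)%:R = 0.
  by move=> cb; apply: big1 => s _; rewrite eqseq_cons eq_sym (negbTE cb) mulr0.
have cons_eq : \sum_(s <- words N) f (b :: s) * (b :: t == b :: s)%:R = f (b :: t).
  by under eq_bigr do rewrite eqseq_cons eqxx /=; exact: (tN (fun s => f (b :: s))).
by case: b cons_neq cons_eq => cn ce; rewrite ce cn// ?addr0 ?add0r.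
Qed.

Definition word_event s : set T :=
  \big[setI/setT]_(i <- iota 0 (size s)) X i @^-1` [set nth false s i].

Lemma word_eventP s w :
  word_event s w <-> mkseq (fun k => X k w) (size s) = s.
Proof.
rewrite /word_event -bigcap_seq /=; split => [h|h i /=].
  apply: (@eq_from_nth _ false); first by rewrite size_mkseq.
  move=> i; rewrite size_mkseq => is_; rewrite nth_mkseq//.
  by apply: (h i); rewrite /= mem_iota add0n is_.
rewrite mem_iota add0n => /= is_.
by rewrite -[in RHS]h nth_mkseq.
Qed.

Lemma measurable_word_event s : measurable (word_event s).
Proof.
apply: bigsetI_measurable => i _.
by rewrite -[_ @^-1` _]setTI; exact: measurable_funP.
Qed.

Lemma probability_word_event s : P (word_event s) = (2^-1 ^+ size s)%:E.
Proof.
rewrite /word_event (flips.1 (iota 0 (size s)) (fun i => [set nth false s i]))//; last first.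
  exact: iota_uniq.
under eq_bigr do rewrite flips.2.
rewrite big_const_seq count_predT size_iota.
by elim: (size s) => //= n ->; rewrite exprS EFinM.
Qed.

Lemma expectation_word (f : seq bool -> R) N :
  ('E_P[fun w => f (mkseq (fun k => X k w) N)])%E = (word_mean N f)%:E.
Proof.
rewrite unlock.
under eq_integral => w _.
  rewrite -(@sum_words_eq N f (mkseq (fun k => X k w) N)) ?size_mkseq// -sumEFin.
  rewrite big_seq (eq_bigr (fun s => (f s * \1_(word_event s) w)%:E)); last first.
    move=> s /size_words sN; congr ((_ * _)%:E); rewrite indicE -sN.
    congr (nat_of_bool _)%:R; apply/idP/idP.
      by move=> /eqP h; apply/mem_set/word_eventP.
    by rewrite inE => /word_eventP ->.
  rewrite -big_seq.
  over.
have int_s s : P.-integrable setT (fun w => (f s * \1_(word_event s) w)%:E).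
  under eq_fun do rewrite EFinM.
  apply: integrableZl => //; apply: integrable_indic => //.
    exact: measurable_word_event.
rewrite integral_sum// word_mean_words -sumEFin.
rewrite big_seq [RHS]big_seq; apply: eq_bigr => s /size_words sN.
under eq_integral do rewrite EFinM.
rewrite integralZl//; last first.
  by apply: integrable_indic => //; exact: measurable_word_event.
rewrite integral_indic//; last exact: measurable_word_event.
by rewrite setIT EFinM -sN; congr (_ * _)%E; exact: probability_word_event.
Qed.
End Expectation.

(** * Existence of the exponent and passage to the infinite series *)

Section Limits.
Variable R : realType.
Implicit Types (f g : seq bool -> R) (s u : seq bool) (k : norm_index).

(** A bounded difference vanishes after division by [n]; this carries the limit from one norm to
    another. *)
Lemma cvg_rate_close f g (C l : R) : (forall s, `|f s - g s| <= C) ->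
  word_mean n f / n%:R @[n --> \oo] --> l ->
  word_mean n g / n%:R @[n --> \oo] --> l.
Proof.
move=> fgC fl.
have close n : `|word_mean n f - word_mean n g| <= C.
  rewrite -word_meanB ler_norml -[X in X <= _](word_mean_cst n (- C)).
  rewrite -[X in _ && (_ <= X)](word_mean_cst n C).
  by rewrite !le_word_mean// => s _; have := fgC s; rewrite ler_norml => /andP[].
have diff0 : (word_mean n f - word_mean n g) / n%:R @[n --> \oo] --> (0 : R).
  apply: (@squeeze_cvgr _ _ _ _ (fun n => (- C) / n%:R) (fun n => C / n%:R)).
  - near=> n; have := close n; rewrite ler_norml => /andP[h1 h2].
    by rewrite !ler_wpM2r ?invr_ge0.
  - exact: cvg_divn.
  - exact: cvg_divn.
have : word_mean n f / n%:R - (word_mean n f - word_mean n g) / n%:R @[n --> \oo] --> l - 0.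
  exact: cvgB.
rewrite subr0; apply: cvg_trans; apply: near_eq_cvg; near=> n => /=; ring.
Unshelve. all: by end_near. Qed.

Lemma cvg_log_vnorm (alpha beta : R) : 1 <= alpha -> 1 <= beta ->
  exists l : R, forall k,
    word_mean n (log_vnorm alpha beta k) / n%:R @[n --> \oo] --> l.
Proof.
move=> al1 be1.
have vec_ge1 := word_vec_ge1 al1 be1.
have log_ge0 s : 0 <= log_vnorm alpha beta k_one s.
  by have [h1 h2] := vec_ge1 s; rewrite ln_ge0//=; lra.
(* Nonnegative matrices preserve the coordinatewise order. Taking for [c] the 1-norm of [w] gives
   subadditivity. *)
have vec_le u (w : R * R) c : w.1 <= c -> w.2 <= c ->
    (foldr (shear_vec alpha beta) w u).1 <= c * (word_vec alpha beta u).1 /\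
    (foldr (shear_vec alpha beta) w u).2 <= c * (word_vec alpha beta u).2.
  move=> w1 w2; elim: u => [|x u [IH1 IH2]] /=; first by rewrite !mulr1.
  have a0 : 0 <= alpha by lra.
  have b0 : 0 <= beta by lra.
  have := ler_wpM2l a0 IH1; have := ler_wpM2l b0 IH2.
  by case: x => /=; split; lra.
have log_sub u s : log_vnorm alpha beta k_one (u ++ s)
    <= log_vnorm alpha beta k_one u + log_vnorm alpha beta k_one s.
  have [h1 h2] := vec_ge1 s; have [h3 h4] := vec_ge1 u.
  rewrite /log_vnorm -lnM ?posrE ?vnorm_word_gt0// ler_ln ?posrE ?mulr_gt0 ?vnorm_word_gt0//=.
  have [||] := vec_le u (word_vec alpha beta s)
    ((word_vec alpha beta s).1 + (word_vec alpha beta s).2); [lra|lra|].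
  by rewrite -foldr_cat => h7 h8; rewrite mulrC mulrDr; exact: lerD.
have [||l l1] := @fekete R (fun n => word_mean n (log_vnorm alpha beta k_one)).
- by move=> n; rewrite -(word_mean_cst n 0); exact: le_word_mean.
- move=> m n; rewrite word_mean_cat.
  rewrite -[X in _ <= _ + X](word_mean_cst m) -word_meanD.
  apply: le_word_mean => u _.
  rewrite -[X in _ <= X + _](word_mean_cst n) -word_meanD.
  exact: le_word_mean.
exists l => k; apply: (cvg_rate_close (C := ln 2) _ l1) => s.
have [h1 h2] := vec_ge1 s.
have w1 : 0 <= (word_vec alpha beta s).1 by lra.
have w2 : 0 <= (word_vec alpha beta s).2 by lra.
have /andP[e1 e2] := vnorm_equiv k w1 w2.
have p1 := vnorm_word_gt0 al1 be1 k s.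
have p2 := vnorm_word_gt0 al1 be1 k_one s.
have le1 : log_vnorm alpha beta k s <= log_vnorm alpha beta k_one s by rewrite ler_ln.
have le2 : log_vnorm alpha beta k_one s <= ln 2 + log_vnorm alpha beta k s.
  rewrite -lnM ?posrE// ler_ln ?posrE ?mulr_gt0//=; lra.
rewrite ger0_norm; lra.
Qed.

Lemma growth_rate_cvg d (T : measurableType d) (P : probability T R)
    (X : nat -> {RV P >-> bool}) (nu : 'M[R]_2 -> R) (alpha beta : R) (l : R) :
  fair_coin_flips X -> is_norm nu -> 1 <= alpha -> 1 <= beta ->
  word_mean n (log_vnorm alpha beta k_one) / n%:R @[n --> \oo] --> l ->
  growth_rate X nu alpha beta @ \oo --> l%:E.
Proof.
move=> flips nun al1 be1 cvl.
have al0 : 0 <= alpha by lra.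
have be0 : 0 <= beta by lra.
have [c [C [c0 C0 lower upper]]] := mx_norm_equiv nun.
pose f s := ln (nu (word_mx alpha beta s)).
have -> : growth_rate X nu alpha beta = fun n => (word_mean n f / n%:R)%:E.
  apply/funext => n; rewrite /growth_rate mulrC EFinM -(expectation_word flips).
  by congr (_ * 'E_P[_])%E; apply/funext => w; rewrite /f -prod_mkseq.
suff : word_mean n f / n%:R @[n --> \oo] --> l by move=> fl; apply: cvg_EFin; [exact: nearW|].
apply: (cvg_rate_close (C := `|ln (c / 4)| + `|ln C|) _ cvl) => s.
set V := vnorm k_one (word_vec alpha beta s).
have V0 : 0 < V by exact: vnorm_word_gt0.
have up : nu (word_mx alpha beta s) <= C * V.
  by have := upper (word_mx alpha beta s); rewrite word_mx_sum.
(* [V] is the sum of four entries, each at most [nu] of the matrix divided by [c]. *)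
have lo : c / 4 * V <= nu (word_mx alpha beta s).
  have := word_mx_sum al0 be0 s; rewrite -/V !big_ord_recl !big_ord0 !addr0 => <-.
  have h i j := lower (word_mx alpha beta s) i j.
  have := h ord0 ord0; have := h ord0 (lift ord0 ord0).
  have := h (lift ord0 ord0) ord0; have := h (lift ord0 ord0) (lift ord0 ord0).
  by lra.
have c4 : 0 < c / 4 by lra.
have nu0 : 0 < nu (word_mx alpha beta s) by apply: lt_le_trans lo; exact: mulr_gt0.
have : f s <= ln C + ln V by rewrite -lnM ?posrE// ler_ln ?posrE ?mulr_gt0.
have : ln (c / 4) + ln V <= f s by rewrite -lnM ?posrE// ler_ln ?posrE ?mulr_gt0.
rewrite /log_vnorm -/V ler_norml.
have := ler_norm (ln C); have := ler_norm (- ln (c / 4)); rewrite normrN.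
have := normr_ge0 (ln C); have := normr_ge0 (ln (c / 4)).
by lra.
Qed.

Section DoubleSeries.
Variable t : nat -> nat -> R.
Hypothesis t0 : forall a b, 0 <= t a b.

Lemma double_series_le (L : R) :
  (forall K, \sum_(1 <= a < K.+1) \sum_(1 <= b < K.+1) t a b <= L) ->
  (\sum_(1 <= a <oo) \sum_(1 <= b <oo) (t a b)%:E <= L%:E)%E.
Proof.
move=> tL.
have t0' a b : (0 <= (t a b)%:E)%E by rewrite lee_fin.
apply: lime_le; first by apply: is_cvg_nneseries => a _ _; exact: nneseries_ge0.
(* The finite sum over [a] moves inside the series over [b], so that both limits reduce to finite
   rectangles, each contained in a square. *)
apply: nearW => m; rewrite -nneseries_sum_nat//.
apply: lime_le; first by apply: is_cvg_nneseries => b _ _; exact: sume_ge0.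
apply: nearW => n.
under eq_bigr do rewrite sumEFin.
rewrite sumEFin lee_fin exchange_big_nat /=.
pose K := (m + n)%N.
apply: le_trans (tL K).
have sub p (F : nat -> R) : (p <= K.+1)%N -> (forall i, 0 <= F i) ->
    \sum_(1 <= i < p) F i <= \sum_(1 <= i < K.+1) F i.
  move=> pK F0; have [p1|p1] := leqP 1 p; last first.
    by rewrite big_geq ?sumr_ge0//; case: (p) p1.
  by rewrite [leRHS](big_cat_nat p1 pK)/= lerDl sumr_ge0.
apply: (@le_trans _ _ (\sum_(1 <= a < m) \sum_(1 <= b < K.+1) t a b)).
  by apply: ler_sum => a _; apply: sub; rewrite // /K; lia.
by apply: sub => [|a]; [rewrite /K; lia|exact: sumr_ge0].
Qed.

Lemma double_series_ge K :
  ((\sum_(1 <= a < K.+1) \sum_(1 <= b < K.+1) t a b)%:E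
   <= \sum_(1 <= a <oo) \sum_(1 <= b <oo) (t a b)%:E)%E.
Proof.
have t0' a b : (0 <= (t a b)%:E)%E by rewrite lee_fin.
apply: le_trans (nneseries_lim_ge K.+1 _); last first.
  by move=> a _ _; exact: nneseries_ge0.
rewrite -sumEFin; apply: lee_sum => a _.
rewrite -sumEFin; exact: nneseries_lim_ge.
Qed.
End DoubleSeries.

Lemma sum_geometric K : \sum_(1 <= a < K.+1) (2^-1 : R) ^+ a = 1 - 2^-1 ^+ K.
Proof.
elim: K => [|K IH]; first by rewrite big_geq// expr0 subrr.
by rewrite big_nat_recr//= IH exprS; field.
Qed.

Lemma sum_arith_geometric K : \sum_(1 <= a < K.+1) (2^-1 : R) ^+ a * a%:R
  = 2 - (K%:R + 2) * 2^-1 ^+ K.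
Proof.
elim: K => [|K IH]; first by rewrite big_geq// expr0; ring.
by rewrite big_nat_recr//= IH exprS -natr1; field.
Qed.

(** The limit 4 is the mean block length. With [x = K.+1] and [e = 2^-1 ^+ K.+1], both [e] and
    [x * e] are at most [4 / x], and the error is at most [2 * x * e + 8 * e]. *)
Lemma sum_block_length K : 4 - 40 / K.+1%:R <=
  \sum_(1 <= a < K.+2) \sum_(1 <= b < K.+2) (2^-1 : R) ^+ (a + b) * (a + b)%:R.
Proof.
have -> : \sum_(1 <= a < K.+2) \sum_(1 <= b < K.+2) (2^-1 : R) ^+ (a + b) * (a + b)%:R
  = 2 * (1 - 2^-1 ^+ K.+1) * (2 - (K.+1%:R + 2) * 2^-1 ^+ K.+1).
  rewrite -sum_geometric -sum_arith_geometric.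
  under eq_bigr => a _.
    under eq_bigr => b _.
      rewrite exprD natrD (_ : _ * _ = 2^-1 ^+ a * a%:R * 2^-1 ^+ b
        + 2^-1 ^+ a * (2^-1 ^+ b * b%:R)); last by ring.
      over.
    rewrite big_split /= -!mulr_sumr.
    over.
  by rewrite big_split /= -!mulr_suml; ring.
have sq : (K.+1 * K.+1 <= 4 * 2 ^ K.+1)%N.
  elim: K => // K IH; rewrite (expnS 2 K.+1).
  have := ltn_expl K.+1 (isT : (1 < 2)%N); lia.
have n0 : (0 : R) < K.+1%:R by rewrite ltr0n.
have d0 : (0 : R) < 2^-1 ^+ K.+1 by rewrite exprn_gt0// invr_gt0.
have dE : K.+1%:R ^+ 2 * 2^-1 ^+ K.+1 <= 4 :> R.
  rewrite exprVn ler_pdivrMr ?exprn_gt0//.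
  by rewrite -!natrX -natrM ler_nat expnS expn1.
move: sq => _; have n1 : (1 : R) <= K.+1%:R by rewrite ler1n.
move: (K.+1%:R : R) (2^-1 ^+ K.+1 : R) n0 n1 d0 dE => x e x0 x1 e0 xe.
have xe' : x * e <= 4 / x by rewrite ler_pdivlMr// mulrAC -expr2.
have e' : e <= 4 / x by apply: le_trans xe'; apply: ler_peMl => //; exact: ltW.
have -> : 40 / x = 10 * (4 / x) by field; rewrite gt_eqF.
have xee : 0 <= (x + 2) * e ^+ 2 by rewrite mulr_ge0 ?sqr_ge0//; lra.
move: xe' e' xee; move: (4 / x) => z; nra.
Qed.

Lemma growth_ge1 k (p q s : R) : 0 <= p -> 0 <= q -> 0 <= s -> 1 <= growth k p q s.
Proof.
move=> p0 q0 s0; have pq0 : 0 <= p * q by exact: mulr_ge0.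
have qs0 : 0 <= q * s by exact: mulr_ge0.
have pqs0 : 0 <= p * q * s by exact: mulr_ge0.
case: k => /=; last by lra.
- by rewrite ler_pdivlMr; lra.
- have sq (x y : R) : 0 <= y -> y <= x -> y ^+ 2 <= x ^+ 2.
    by move=> y0 yx; rewrite lerXn2r// nnegrE// (le_trans y0).
  rewrite le_min; apply/andP; split; rewrite -[leLHS](@sqrtr1 R); apply: ler_wsqrtr.
    have : (1 : R) ^+ 2 <= (1 + p * q) ^+ 2 by apply: sq; lra.
    by have := sqr_ge0 q; rewrite expr1n; lra.
  have s2 := sqr_ge0 s; rewrite /sqr_growth ler_pdivlMr; last by lra.
  have : (1 : R) ^+ 2 <= (1 + q * s) ^+ 2 by apply: sq; lra.
  have : s ^+ 2 <= (p + (1 + p * q) * s) ^+ 2 by apply: sq; lra.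
  by rewrite expr1n; lra.
Qed.

Lemma phihat_mean_ge1 k (a b alpha beta : R) : 0 <= a -> 0 <= b ->
  1 <= alpha -> 1 <= beta ->
  1 <= 3^-1 * \sum_(1 <= m < 4) phihat k m a b alpha beta.
Proof.
move=> a0 b0 al1 be1.
have [p1 p2 p3] := phihatE k a b al1 be1.
have [/= c0 c2] := andP (alpha_frac_bound al1 be1).
have p0 : 0 <= a * alpha by apply: mulr_ge0; lra.
have q0 : 0 <= b * beta by apply: mulr_ge0; lra.
have g (s : R) : 0 <= s -> 1 <= growth k (a * alpha) (b * beta) s by exact: growth_ge1.
rewrite sum3E p1 p2 p3 /third_slope /=.
have h1 := g _ (le_trans ler01 al1).
have h2 := g _ (addr_ge0 (le_trans ler01 al1) c0).
have h3 : 1 <= growth k (a * alpha) (b * beta) (2 * alpha + alpha / (1 + alpha * beta)).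
  by apply: g; lra.
by lra.
Qed.

Lemma psihat_mean_ge1 k (a b alpha beta : R) : 0 <= a -> 0 <= b ->
  1 <= alpha -> 1 <= beta ->
  1 <= 3^-1 * \sum_(1 <= m < 4) psihat k m a b alpha beta.
Proof.
move=> a0 b0 al1 be1; rewrite sum3E.
have al0 : 0 <= alpha by lra.
have be0 : 0 <= beta by lra.
have ab0 : 0 <= a * alpha * b * beta by rewrite !mulr_ge0.
have bb0 : 0 <= b * beta by rewrite mulr_ge0.
have x0 : 0 <= alpha * beta by rewrite mulr_ge0.
case: k => /=.
- by rewrite /psihat_one; lra.
- rewrite /psihat_two; set C := calC _ _ _ _.
  have C0 : 0 <= C by rewrite /C /calC addr_ge0 ?sqr_ge0.
  have r0 := sqrtr_ge0 (C * (C + 4)).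
  have : 1 <= Num.sqrt (1 / 2 * (2 + C + Num.sqrt (C * (C + 4)))).
    by rewrite -[leLHS](@sqrtr1 R); apply: ler_wsqrtr; lra.
  by lra.
- have h1 : 0 <= a * (1 + alpha * beta) / (2 + alpha * beta).
    by rewrite divr_ge0 ?mulr_ge0//; lra.
  have h2 : 0 <= a * (1 + alpha * beta) / (3 + 2 * alpha * beta).
    by rewrite divr_ge0 ?mulr_ge0//; nra.
  by lra.
Qed.

Lemma Lhat_le k (alpha beta l : R) : 1 <= alpha -> 1 <= beta ->
  word_mean n (log_vnorm alpha beta k) / n%:R @[n --> \oo] --> l ->
  (Lhat k alpha beta <= (4 * l)%:E)%E.
Proof.
move=> al1 be1 cvl; apply: double_series_le => [a b|K].
  by rewrite mulr_ge0 ?exprn_ge0 ?invr_ge0// ln_ge0// phihat_mean_ge1.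
exact: lower_rate.
Qed.

Lemma Uhat_ge k (alpha beta l : R) : 1 <= alpha -> 1 <= beta ->
  word_mean n (log_vnorm alpha beta k) / n%:R @[n --> \oo] --> l ->
  ((4 * l)%:E <= Uhat k alpha beta)%E.
Proof.
move=> al1 be1 cvl; apply/lee_addgt0Pr => e e0.
pose t a b : R := 2^-1 ^+ (a + b) *
  ln (3^-1 * \sum_(1 <= m < 4) psihat k m a%:R b%:R alpha beta).
have t0 a b : 0 <= t a b.
  by rewrite mulr_ge0 ?exprn_ge0 ?invr_ge0// ln_ge0// psihat_mean_ge1.
set c := ln (1 + alpha + beta).
have c0 : 0 <= c by rewrite ln_ge0; lra.
near \oo => K.
(* [K] is so large that truncating the mean block length costs at most [e]. *)
have small : c * (40 / K.+1%:R) <= e.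
  rewrite mulrA ler_pdivrMr// -ler_pdivrMl//.
  apply: (@le_trans _ _ K%:R); last by rewrite ler_nat.
  by near: K; exact: nbhs_infty_ger.
have := upper_rate al1 be1 K.+1 cvl; rewrite -/c.
have -> : \sum_(1 <= a < K.+2) \sum_(1 <= b < K.+2) (2^-1 : R) ^+ (a + b) *
    (c * (a + b)%:R - ln (3^-1 * \sum_(1 <= m < 4) psihat k m a%:R b%:R alpha beta))
  = c * (\sum_(1 <= a < K.+2) \sum_(1 <= b < K.+2) (2^-1 : R) ^+ (a + b) * (a + b)%:R)
    - \sum_(1 <= a < K.+2) \sum_(1 <= b < K.+2) t a b.
  rewrite mulr_sumr -sumrB; apply: eq_bigr => a _.
  rewrite mulr_sumr -sumrB; apply: eq_bigr => b _.
  by rewrite /t; ring.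
move=> rate.
have := ler_wpM2l c0 (sum_block_length K); rewrite mulrBr => len.
apply: le_trans (leeD2r _ (double_series_ge t0 K.+1)).
rewrite -EFinD lee_fin.
move: (c * (40 / _)) small len => z ze len.
move: (c * \sum_(1 <= a < K.+2) _) rate len => L.
move: (\sum_(1 <= a < K.+2) _) => U rate len.
by apply: (@le_trans _ _ (U + z)); [lra|rewrite lerD2l].
Unshelve. all: by end_near. Qed.
End Limits.

Theorem theorem2 (R : realType) (d : measure_display) (T : measurableType d)
    (P : probability T R) (X : nat -> {RV P >-> bool})
    (nu : 'M[R]_2 -> R) (alpha beta : R) :
  fair_coin_flips X -> is_norm nu -> 1 <= alpha -> 1 <= beta ->
  [/\ cvgn (growth_rate X nu alpha beta),
      (Order.max (Lhat k_one alpha beta)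
         (Order.max (Lhat k_two alpha beta) (Lhat k_infty alpha beta))
       <= 4%:E * lyapunov_exponent X nu alpha beta)%E
    & (4%:E * lyapunov_exponent X nu alpha beta
       <= Order.min (Uhat k_one alpha beta)
            (Order.min (Uhat k_two alpha beta) (Uhat k_infty alpha beta)))%E].
Proof.
move=> flips nun al1 be1.
(* One limit [l] serves all three vector norms, hence all six bounds. *)
have [l rate] := cvg_log_vnorm al1 be1.
have cvl := growth_rate_cvg flips nun al1 be1 (rate k_one).
rewrite /lyapunov_exponent (cvg_lim _ cvl)// -EFinM; split.
- exact: cvl.
- by rewrite !ge_max !(Lhat_le al1 be1 (rate _)).
- by rewrite !le_min !(Uhat_ge al1 be1 (rate _)).
Qed.
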